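(* Let $t\in\mathbb{T}$ and $y\in l^2_{\mathbb{F}}(t;\mathbb{R}^{\widetilde n})$. For the initial pair $(t,y)$, the following statements are equivalent. i) Problem (GLQ) admits an open-loop equilibrium. ii) There exists $(u^*,v^* )\in l^2_{\mathbb{F}}(\mathbb{T}_t;\mathbb{R}^{m_1})\times l^2_{\mathbb{F}}(\mathbb{T}_t;\mathbb{R}^{m_2})$ such that the stationary conditions $$0=S^{1(1)}_{t,k}X^*_k+\bar S^{1(1)}_{t,k}\mathbb{E}_tX^*_k+R^{1(11)}_{t,k}u^*_k+\bar R^{1(11)}_{t,k}\mathbb{E}_tu^*_k+R^{1(12)}_{t,k}v^*_k+\bar R^{1(12)}_{t,k}\mathbb{E}_tv^*_k+(B^1_k)^T\mathbb{E}_kY^*_{k+1}+\sum_{i=1}^p(D^{1i}_k)^T\mathbb{E}_k(Y^*_{k+1}w^i_k)+\rho^{1(1)}_{t,k},$$ $$0=\mathcal{S}^{2(2)}_{k,k}X^*_k+\mathcal{R}^{2(21)}_{k,k}u^*_k+\mathcal{R}^{2(22)}_{k,k}v^*_k+(B^2_k)^T\mathbb{E}_kZ^{k,*}_{k+1}+\sum_{i=1}^p(D^{2i}_k)^T\mathbb{E}_k(Z^{k,*}_{k+1}w^i_k)+\rho^{2(2)}_{k,k}$$ hold a.s. for all $k\in\mathbb{T}_t$, and the convex conditions $$\inf_{u\in l^2_{\mathbb{F}}(\mathbb{T}_t;\mathbb{R}^{m_1})}\widetilde J_1(t,0;u)\ge 0\ \text{ a.s.},\qquad \inf_{v_k\in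 l^2_{\mathbb{F}}(k;\mathbb{R}^{m_2})}\widetilde J_2(k,0;v_k)\ge 0\ \text{ a.s.},\ \forall k\in\mathbb{T}_t$$ are satisfied. Here $X^*$ is given by $$X^*_{k+1}=A_kX^*_k+B^1_ku^*_k+B^2_kv^*_k+\sum_{i=1}^p\big(C^i_kX^*_k+D^{1i}_ku^*_k+D^{2i}_kv^*_k\big)w^i_k,\quad X^*_t=y,\ k\in\mathbb{T}_t,$$ and $Y^*$, $Z^{k,*}$ ($k\in\mathbb{T}_t$) are computed via the backward stochastic difference equations $$Y^*_k=Q^1_{t,k}X^*_k+\bar Q^1_{t,k}\mathbb{E}_tX^*_k+(S^{1(1)}_{t,k})^Tu^*_k+(\bar S^{1(1)}_{t,k})^T\mathbb{E}_tu^*_k+(S^{1(2)}_{t,k})^Tv^*_k+(\bar S^{1(2)}_{t,k})^T\mathbb{E}_tv^*_k+A_k^T\mathbb{E}_kY^*_{k+1}+\sum_{i=1}^p(C^i_k)^T\mathbb{E}_k(Y^*_{k+1}w^i_k)+q^1_{t,k},$$ $$Y^*_N=G^1_tX^*_N+\bar G^1_t\mathbb{E}_tX^*_N+g^1_t,\quad k\in\mathbb{T}_t,$$ and, for each $k\in\mathbb{T}_t$, $$Z^{k,*}_\ell=Q^2_{k,\ell}X^*_\ell+\bar Q^2_{k,\ell}\mathbb{E}_kX^*_\ell+(S^{2(1)}_{k,\ell})^Tu^*_\ell+(\bar S^{2(1)}_{k,\ell})^T\mathbb{E}_ku^*_\ell+(S^{2(2)}_{k,\ell})^Tv^*_\ell+(\bar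 S^{2(2)}_{k,\ell})^T\mathbb{E}_kv^*_\ell+A_\ell^T\mathbb{E}_\ell Z^{k,*}_{\ell+1}+\sum_{i=1}^p(C^i_\ell)^T\mathbb{E}_\ell(Z^{k,*}_{\ell+1}w^i_\ell)+q^2_{k,\ell},$$ $$Z^{k,*}_N=G^2_kX^*_N+\bar G^2_k\mathbb{E}_kX^*_N+g^2_k,\quad \ell\in\mathbb{T}_k.$$ The functionals $\widetilde J_1,\widetilde J_2$ are $$\widetilde J_1(t,0;u)=\sum_{k=t}^{N-1}\mathbb{E}_t\Big[\alpha_k^TQ^1_{t,k}\alpha_k+2u_k^TS^{1(1)}_{t,k}\alpha_k+u_k^TR^{1(11)}_{t,k}u_k+(\mathbb{E}_t\alpha_k)^T\bar Q^1_{t,k}\mathbb{E}_t\alpha_k+2(\mathbb{E}_tu_k)^T\bar S^{1(1)}_{t,k}\mathbb{E}_t\alpha_k+(\mathbb{E}_tu_k)^T\bar R^{1(11)}_{t,k}\mathbb{E}_tu_k\Big]+\mathbb{E}_t[\alpha_N^TG^1_t\alpha_N]+(\mathbb{E}_t\alpha_N)^T\bar G^1_t\mathbb{E}_t\alpha_N,$$ $$\widetilde J_2(k,0;v_k)=v_k^T\mathcal{R}^{2(22)}_{k,k}v_k+\sum_{\ell=k}^{N-1}\mathbb{E}_k\Big[\beta_\ell^TQ^2_{k,\ell}\beta_\ell+(\mathbb{E}_k\beta_\ell)^T\bar Q^2_{k,\ell}\mathbb{E}_k\beta_\ell\Big]+\mathbb{E}_k[\beta_N^TG^2_k\beta_N]+(\mathbb{E}_k\beta_N)^T\bar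 G^2_k\mathbb{E}_k\beta_N,$$ with $$\alpha_{k+1}=A_k\alpha_k+B^1_ku_k+\sum_{i=1}^p\big(C^i_k\alpha_k+D^{1i}_ku_k\big)w^i_k,\quad \alpha_t=0,\ k\in\mathbb{T}_t,$$ $$\beta_{\ell+1}=A_\ell\beta_\ell+\sum_{i=1}^pC^i_\ell\beta_\ell w^i_\ell\ (\ell\in\mathbb{T}_{k+1}),\quad \beta_{k+1}=B^2_kv_k+\sum_{i=1}^pD^{2i}_kv_kw^i_k,\quad \beta_k=0.$$ Moreover, under i) or ii), the pair $(u^*,v^* )$ of ii) is an open-loop equilibrium of Problem (GLQ).
   Context: Let $N\ge1$, $\mathbb{T}=\{0,\dots,N-1\}$, $\mathbb{T}_t=\{t,\dots,N-1\}$ (with $\mathbb{T}_N=\emptyset$). On a probability space, $\{w_k=(w^1_k,\dots,w^p_k)^T,\ k\in\mathbb{T}\}$ is a vector-valued martingale difference sequence with $\mathbb{E}_k[w_k]=0$, $\mathbb{E}_k[w_kw_k^T]=\Delta_k=(\delta^{ij}_k)_{p\times p}$ deterministic, where $\mathbb{E}_k[\cdot]=\mathbb{E}[\cdot|\mathbb{F}_k]$, $\mathbb{F}_k=\sigma\{w_l,\ l=0,\dots,k-1\}$, and $\mathbb{F}_0$ is trivial. $l^2_{\mathbb{F}}(t;\mathbb{R}^{n})$ is the set of $\mathbb{F}_t$-measurable square-integrable $\mathbb{R}^n$-valued random variables; $l^2_{\mathbb{F}}(\mathbb{T}_t;\mathbb{R}^{m})$ is the set of processes $\{\nu_k,k\in\mathbb{T}_t\}$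 with $\nu_k\in\mathbb{R}^m$ $\mathbb{F}_k$-measurable and square-integrable. System: for $k\in\mathbb{T}_t$, $$X_{k+1}=A_kX_k+B^1_ku_k+B^2_kv_k+\sum_{i=1}^p\big(C^i_kX_k+D^{1i}_ku_k+D^{2i}_kv_k\big)w^i_k,\qquad X_t=y,$$ with deterministic $A_k,C^i_k\in\mathbb{R}^{\widetilde n\times\widetilde n}$, $B^1_k,D^{1i}_k\in\mathbb{R}^{\widetilde n\times m_1}$, $B^2_k,D^{2i}_k\in\mathbb{R}^{\widetilde n\times m_2}$, and $y\in l^2_{\mathbb{F}}(t;\mathbb{R}^{\widetilde n})$. With $\mathbf{u}_k=(u_k^T,v_k^T)^T$, the costs are, for $j=1,2$, $$J_j(t,y;u,v)=\sum_{k=t}^{N-1}\mathbb{E}_t\Big[X_k^TQ^j_{t,k}X_k+2\mathbf{u}_k^TS^j_{t,k}X_k+\mathbf{u}_k^TR^j_{t,k}\mathbf{u}_k+(\mathbb{E}_tX_k)^T\bar Q^j_{t,k}\mathbb{E}_tX_k+2(\mathbb{E}_t\mathbf{u}_k)^T\bar S^j_{t,k}\mathbb{E}_tX_k+(\mathbb{E}_t\mathbf{u}_k)^T\bar R^j_{t,k}\mathbb{E}_t\mathbf{u}_k+2(q^j_{t,k})^TX_k+2(\rho^j_{t,k})^T\mathbf{u}_k\Big]$$ $$\qquad+\mathbb{E}_t[X_N^TG^j_tX_N]+(\mathbb{E}_tX_N)^T\bar G^j_t\mathbb{E}_tX_N+2(g^j_t)^T\mathbb{E}_tX_N.$$ All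 weights are deterministic (for $t\in\mathbb{T}$, $k\in\mathbb{T}_t$) and $Q^j,\bar Q^j,R^j,\bar R^j,G^j,\bar G^j$ are symmetric. Partition according to $\mathbf{u}=(u,v)$: $S^j_{t,k}$ has blocks $S^{j(1)}_{t,k},S^{j(2)}_{t,k}$ (rows $m_1,m_2$), $R^j_{t,k}$ has blocks $R^{j(rs)}_{t,k}\in\mathbb{R}^{m_r\times m_s}$, $\rho^j_{t,k}$ has blocks $\rho^{j(1)}_{t,k},\rho^{j(2)}_{t,k}$; similarly for barred matrices. Calligraphic letters denote sums: $\mathcal{Q}^j_{t,k}=Q^j_{t,k}+\bar Q^j_{t,k}$, $\mathcal{S}^{j(s)}_{t,k}=S^{j(s)}_{t,k}+\bar S^{j(s)}_{t,k}$, $\mathcal{R}^{j(rs)}_{t,k}=R^{j(rs)}_{t,k}+\bar R^{j(rs)}_{t,k}$, $\mathcal{G}^j_t=G^j_t+\bar G^j_t$. Problem (GLQ), initial pair $(t,y)$: find $(u^*,v^* )\in l^2_{\mathbb{F}}(\mathbb{T}_t;\mathbb{R}^{m_1})\times l^2_{\mathbb{F}}(\mathbb{T}_t;\mathbb{R}^{m_2})$ such that $$J_1(t,y;u^*,v^* )\le J_1(t,y;u,v^* )\quad\forall u\in l^2_{\mathbb{F}}(\mathbb{T}_t;\mathbb{R}^{m_1}),$$ $$J_2(k,X^*_k;u^*|_{\mathbb{T}_k},v^*|_{\mathbb{T}_k})\le J_2(k,X^*_k;u^*|_{\mathbb{T}_k},(v_k,v^*|_{\mathbb{T}_{k+1}}))\quad\forall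 k\in\mathbb{T}_t,\ \forall v_k\in l^2_{\mathbb{F}}(k;\mathbb{R}^{m_2}),$$ where $X^*$ is the state under $(u^*,v^* )$ with $X^*_t=y$. Such a pair is called an open-loop equilibrium of Problem (GLQ). Inequalities between random variables are a.s.; ''$\inf_u\widetilde J_1(t,0;u)\ge0$ a.s.'' means $\widetilde J_1(t,0;u)\ge0$ a.s. for every admissible $u$ (similarly for $\widetilde J_2$). *)

(* Defs.v *)
From HB Require Import structures.
From mathcomp Require Import all_boot all_order all_algebra.
From mathcomp Require Import all_classical all_reals all_analysis.

Set Implicit Arguments.
Unset Strict Implicit.
Unset Printing Implicit Defensive.

Import Order.TTheory GRing.Theory Num.Theory.
Import numFieldNormedType.Exports.

Local Open Scope classical_set_scope.
Local Open Scope ring_scope.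

(** Time-indexed families are functions on [nat]; only the values at the times
    of the horizon are ever used. *)

Section conditional_expectation.
Context {d : measure_display} {T : measurableType d} {R : realType}.
Variable P : probability T R.
Variables (p : nat) (w : nat -> T -> 'cV[R]_p).

(** [<<s noise_gen k >>] is F_k = sigma(w_0, .., w_(k-1)); it is trivial for
    [k = 0] because [noise_gen 0] is empty. *)
Definition noise_gen (k : nat) : set (set T) :=
  [set A | exists (l : nat) (i : 'I_p), (l < k)%N /\
     preimage_set_system [set: T] (fun x => w l x i 0) measurable A].

Definition F_measurable (k : nat) (X : T -> R) : Prop :=
  measurable_fun [set: g_sigma_algebraType (noise_gen k)] X.

Definition is_condexp (k : nat) (X Y : T -> R) : Prop :=
  [/\ P.-integrable [set: T] (EFin \o X),
      P.-integrable [set: T] (EFin \o Y),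
      F_measurable k Y &
      forall A, <<s noise_gen k >> A ->
        (\int[P]_(x in A) (Y x)%:E = \int[P]_(x in A) (X x)%:E)%E].

(** A chosen version of E[X | F_k]; it is the constant 0 when [X] is not
    integrable. *)
Definition condexp (k : nat) (X : T -> R) : T -> R :=
  xget (cst 0) [set Y | is_condexp k X Y].

Definition condexp_mx (r c : nat) (k : nat) (X : T -> 'M[R]_(r, c)) :
    T -> 'M[R]_(r, c) :=
  fun x => \matrix_(i, j) condexp k (fun z => X z i j) x.

Definition l2F (r : nat) (k : nat) (X : T -> 'cV[R]_r) : Prop :=
  forall i, F_measurable k (fun x => X x i 0) /\
            (fun x => X x i 0) \in Lfun P 2%:E.

Definition l2F_process (r N t : nat) (U : nat -> T -> 'cV[R]_r) : Prop :=
  forall k, (t <= k < N)%N -> l2F k (U k).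

(** [w k] is F_(k+1)-measurable by definition of the filtration. *)
Definition martingale_difference (N : nat) (Delta : nat -> 'M[R]_p) : Prop :=
  forall k, (k < N)%N ->
    [/\ forall i, (fun x => w k x i 0) \in Lfun P 2%:E,
        {ae P, forall x, condexp_mx k (w k) x = 0} &
        {ae P, forall x,
          condexp_mx k (fun z => w k z *m (w k z)^T) x = Delta k}].

End conditional_expectation.

Definition dot (R : realType) (r : nat) (a b : 'cV[R]_r) : R :=
  (a^T *m b) 0 0.

Definition bil (R : realType) (r c : nat)
    (a : 'cV[R]_r) (M : 'M[R]_(r, c)) (b : 'cV[R]_c) : R :=
  (a^T *m M *m b) 0 0.

Record system (R : realType) (n m1 m2 p : nat) := System {
  sA  : nat -> 'M[R]_n;
  sB1 : nat -> 'M[R]_(n, m1);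
  sB2 : nat -> 'M[R]_(n, m2);
  sC  : nat -> 'I_p -> 'M[R]_n;
  sD1 : nat -> 'I_p -> 'M[R]_(n, m1);
  sD2 : nat -> 'I_p -> 'M[R]_(n, m2) }.

(** The weights of one player; a suffix [b] marks the barred matrices. *)
Record weights (R : realType) (n m1 m2 : nat) := Weights {
  wQ   : nat -> nat -> 'M[R]_n;
  wQb  : nat -> nat -> 'M[R]_n;
  wS   : nat -> nat -> 'M[R]_(m1 + m2, n);
  wSb  : nat -> nat -> 'M[R]_(m1 + m2, n);
  wR   : nat -> nat -> 'M[R]_(m1 + m2);
  wRb  : nat -> nat -> 'M[R]_(m1 + m2);
  wq   : nat -> nat -> 'cV[R]_n;
  wrho : nat -> nat -> 'cV[R]_(m1 + m2);
  wG   : nat -> 'M[R]_n;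
  wGb  : nat -> 'M[R]_n;
  wg   : nat -> 'cV[R]_n }.

Definition symmetric_weights (R : realType) (n m1 m2 N : nat)
    (W : weights R n m1 m2) : Prop :=
  (forall t k, (t <= k < N)%N ->
     [/\ (wQ W t k)^T = wQ W t k, (wQb W t k)^T = wQb W t k,
         (wR W t k)^T = wR W t k & (wRb W t k)^T = wRb W t k]) /\
  (forall t, (t < N)%N -> (wG W t)^T = wG W t /\ (wGb W t)^T = wGb W t).

Section blocks.
Context {R : realType} {n m1 m2 : nat}.
Variables (W : weights R n m1 m2) (t k : nat).

Definition S_1    : 'M[R]_(m1, n)  := usubmx (wS W t k).
Definition S_2    : 'M[R]_(m2, n)  := dsubmx (wS W t k).
Definition Sb_1   : 'M[R]_(m1, n)  := usubmx (wSb W t k).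
Definition Sb_2   : 'M[R]_(m2, n)  := dsubmx (wSb W t k).
Definition R_11   : 'M[R]_(m1, m1) := ulsubmx (wR W t k).
Definition R_12   : 'M[R]_(m1, m2) := ursubmx (wR W t k).
Definition R_21   : 'M[R]_(m2, m1) := dlsubmx (wR W t k).
Definition R_22   : 'M[R]_(m2, m2) := drsubmx (wR W t k).
Definition Rb_11  : 'M[R]_(m1, m1) := ulsubmx (wRb W t k).
Definition Rb_12  : 'M[R]_(m1, m2) := ursubmx (wRb W t k).
Definition Rb_21  : 'M[R]_(m2, m1) := dlsubmx (wRb W t k).
Definition Rb_22  : 'M[R]_(m2, m2) := drsubmx (wRb W t k).
Definition rho_1  : 'cV[R]_m1      := usubmx (wrho W t k).
Definition rho_2  : 'cV[R]_m2      := dsubmx (wrho W t k).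
Definition calS_2  : 'M[R]_(m2, n)  := S_2 + Sb_2.
Definition calR_21 : 'M[R]_(m2, m1) := R_21 + Rb_21.
Definition calR_22 : 'M[R]_(m2, m2) := R_22 + Rb_22.

End blocks.

(** [run f s x k] is the solution at time [k >= s] of
    [X (l+1) = f l (X l)], [X s = x]. *)
Fixpoint iterate_from (V : Type) (f : nat -> V -> V) (s : nat) (x : V)
    (j : nat) : V :=
  if j is j'.+1 then f (s + j')%N (iterate_from f s x j') else x.

Definition run (V : Type) (f : nat -> V -> V) (s : nat) (x : V) (k : nat) : V :=
  iterate_from f s x (k - s).

Lemma run_init (V : Type) (f : nat -> V -> V) s x : run f s x s = x.
Proof. by rewrite /run subnn. Qed.

Lemma run_step (V : Type) (f : nat -> V -> V) s x k :
  (s <= k)%N -> run f s x k.+1 = f k (run f s x k).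
Proof. by move=> sk; rewrite /run subSn //= subnKC. Qed.

(** [run_back f N x k] is the solution at time [k <= N] of
    [Y l = f l (Y (l+1))], [Y N = x]. *)
Fixpoint iterate_back (V : Type) (f : nat -> V -> V) (N : nat) (x : V)
    (j : nat) : V :=
  if j is j'.+1 then f (N - j)%N (iterate_back f N x j') else x.

Definition run_back (V : Type) (f : nat -> V -> V) (N : nat) (x : V)
    (k : nat) : V :=
  iterate_back f N x (N - k).

Lemma run_back_final (V : Type) (f : nat -> V -> V) N x : run_back f N x N = x.
Proof. by rewrite /run_back subnn. Qed.

Lemma run_back_step (V : Type) (f : nat -> V -> V) N x k :
  (k < N)%N -> run_back f N x k = f k (run_back f N x k.+1).
Proof.
move=> kN; rewrite /run_back -(subnSK kN) /= subnSK //.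
by rewrite subKn // ltnW.
Qed.

Section game.
Context {d : measure_display} {T : measurableType d} {R : realType}.
Variable P : probability T R.
Context {n m1 m2 p : nat}.
Variables (N : nat) (w : nat -> T -> 'cV[R]_p) (sys : system R n m1 m2 p).
Variables (W1 W2 : weights R n m1 m2).

Local Notation E := (condexp P w).
Local Notation EM := (condexp_mx P w).
Local Notation rv r := (T -> 'cV[R]_r).

Definition state (t : nat) (y : rv n) (u : nat -> rv m1) (v : nat -> rv m2) :
    nat -> rv n :=
  run (fun k X x =>
    sA sys k *m X x + sB1 sys k *m u k x + sB2 sys k *m v k x
    + \sum_(i < p) w k x i 0 *:
        (sC sys k i *m X x + sD1 sys k i *m u k x + sD2 sys k i *m v k x)) t y.

Definition J (W : weights R n m1 m2) (t : nat) (y : rv n)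
    (u : nat -> rv m1) (v : nat -> rv m2) : T -> R :=
  let X := state t y u v in
  let uv k z := col_mx (u k z) (v k z) in
  fun x =>
    \sum_(t <= k < N)
      E t (fun z =>
          bil (X k z) (wQ W t k) (X k z)
        + 2 * bil (uv k z) (wS W t k) (X k z)
        + bil (uv k z) (wR W t k) (uv k z)
        + bil (EM t (X k) z) (wQb W t k) (EM t (X k) z)
        + 2 * bil (EM t (uv k) z) (wSb W t k) (EM t (X k) z)
        + bil (EM t (uv k) z) (wRb W t k) (EM t (uv k) z)
        + 2 * dot (wq W t k) (X k z)
        + 2 * dot (wrho W t k) (uv k z)) x
    + E t (fun z => bil (X N z) (wG W t) (X N z)) x
    + bil (EM t (X N) x) (wGb W t) (EM t (X N) x)
    + 2 * dot (wg W t) (EM t (X N) x).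

Definition replace_at (V : Type) (k : nat) (a : V) (v : nat -> V) : nat -> V :=
  fun l => if l == k then a else v l.

Definition open_loop_equilibrium (t : nat) (y : rv n)
    (u : nat -> rv m1) (v : nat -> rv m2) : Prop :=
  [/\ l2F_process P w N t u, l2F_process P w N t v,
      forall u' : nat -> rv m1, l2F_process P w N t u' ->
        {ae P, forall x, J W1 t y u v x <= J W1 t y u' v x} &
      forall k, (t <= k < N)%N -> forall vk : rv m2, l2F P w k vk ->
        {ae P, forall x,
          J W2 k (state t y u v k) u v x
          <= J W2 k (state t y u v k) u (replace_at k vk v) x}].

(** The backward equations of Y and of Z^k have the same form: with initial
    pair (t, y), Y is [adjoint W1 t X u v] and Z^k is [adjoint W2 k X u v], for
    the same state [X] started at (t, y). *)
Definition adjoint (W : weights R n m1 m2) (s : nat) (X : nat -> rv n)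
    (u : nat -> rv m1) (v : nat -> rv m2) : nat -> rv n :=
  run_back (fun l Y x =>
      wQ W s l *m X l x + wQb W s l *m EM s (X l) x
      + (S_1 W s l)^T *m u l x + (Sb_1 W s l)^T *m EM s (u l) x
      + (S_2 W s l)^T *m v l x + (Sb_2 W s l)^T *m EM s (v l) x
      + (sA sys l)^T *m EM l Y x
      + \sum_(i < p) (sC sys l i)^T *m EM l (fun z => w l z i 0 *: Y z) x
      + wq W s l)
    N (fun x => wG W s *m X N x + wGb W s *m EM s (X N) x + wg W s).

Definition stationary (t : nat) (y : rv n)
    (u : nat -> rv m1) (v : nat -> rv m2) : Prop :=
  let X := state t y u v in
  let Y := adjoint W1 t X u v in
  let Z k := adjoint W2 k X u v in
  forall k, (t <= k < N)%N ->
    {ae P, forall x,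
       0 = S_1 W1 t k *m X k x + Sb_1 W1 t k *m EM t (X k) x
         + R_11 W1 t k *m u k x + Rb_11 W1 t k *m EM t (u k) x
         + R_12 W1 t k *m v k x + Rb_12 W1 t k *m EM t (v k) x
         + (sB1 sys k)^T *m EM k (Y k.+1) x
         + \sum_(i < p)
             (sD1 sys k i)^T *m EM k (fun z => w k z i 0 *: Y k.+1 z) x
         + rho_1 W1 t k} /\
    {ae P, forall x,
       0 = calS_2 W2 k k *m X k x
         + calR_21 W2 k k *m u k x + calR_22 W2 k k *m v k x
         + (sB2 sys k)^T *m EM k (Z k k.+1) x
         + \sum_(i < p)
             (sD2 sys k i)^T *m EM k (fun z => w k z i 0 *: Z k k.+1 z) x
         + rho_2 W2 k k}.

Definition alpha (t : nat) (u : nat -> rv m1) : nat -> rv n :=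
  run (fun k a x =>
    sA sys k *m a x + sB1 sys k *m u k x
    + \sum_(i < p) w k x i 0 *: (sC sys k i *m a x + sD1 sys k i *m u k x))
    t (cst 0).

Definition J1_tilde (t : nat) (u : nat -> rv m1) : T -> R :=
  let a := alpha t u in
  fun x =>
    \sum_(t <= k < N)
      E t (fun z =>
          bil (a k z) (wQ W1 t k) (a k z)
        + 2 * bil (u k z) (S_1 W1 t k) (a k z)
        + bil (u k z) (R_11 W1 t k) (u k z)
        + bil (EM t (a k) z) (wQb W1 t k) (EM t (a k) z)
        + 2 * bil (EM t (u k) z) (Sb_1 W1 t k) (EM t (a k) z)
        + bil (EM t (u k) z) (Rb_11 W1 t k) (EM t (u k) z)) x
    + E t (fun z => bil (a N z) (wG W1 t) (a N z)) x
    + bil (EM t (a N) x) (wGb W1 t) (EM t (a N) x).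

Definition beta (k : nat) (vk : rv m2) (l : nat) : rv n :=
  if (l <= k)%N then cst 0 else
  run (fun l' b x =>
         sA sys l' *m b x + \sum_(i < p) w l' x i 0 *: (sC sys l' i *m b x))
      k.+1
      (fun x => sB2 sys k *m vk x + \sum_(i < p) w k x i 0 *: (sD2 sys k i *m vk x))
      l.

Definition J2_tilde (k : nat) (vk : rv m2) : T -> R :=
  let b := beta k vk in
  fun x =>
    bil (vk x) (calR_22 W2 k k) (vk x)
    + \sum_(k <= l < N)
        E k (fun z =>
            bil (b l z) (wQ W2 k l) (b l z)
          + bil (EM k (b l) z) (wQb W2 k l) (EM k (b l) z)) x
    + E k (fun z => bil (b N z) (wG W2 k) (b N z)) x
    + bil (EM k (b N) x) (wGb W2 k) (EM k (b N) x).

Definition convex_conditions (t : nat) : Prop :=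
  (forall u : nat -> rv m1, l2F_process P w N t u ->
     {ae P, forall x, 0 <= J1_tilde t u x}) /\
  (forall k, (t <= k < N)%N -> forall vk : rv m2, l2F P w k vk ->
     {ae P, forall x, 0 <= J2_tilde k vk x}).

End game.

(* Main.v *)
(** Perturbing the controls by [h] changes the state by the response [xi] to [h]
    started at 0, and the cost is quadratic, so the perturbed cost is
    [J + 2 * L h + q xi h] with [L] linear and [q] quadratic.  Summing
    E[xi_(k+1)^T Y_(k+1)] - E[xi_k^T Y_k] over k with the backward equation of
    the costate [Y] rewrites [L h] as the sum of the E[h_k^T H_k], where [H_k] is
    the right-hand side of the stationary condition.  Scaling [h] by small reals
    of both signs shows that J is minimal if and only if [L] vanishes, that is
    H_k = 0, and [q] is nonnegative; [q] is the functional of the convex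
    condition, since the response is [alpha] for the first player and [beta] for
    the second.

    Identities between F_t-conditional expectations are proved as identities
    between the integrals over an arbitrary event of F_t; this turns almost sure
    equalities of random variables into equations between real numbers. *)

Require Import Defs.
From HB Require Import structures.
From mathcomp Require Import all_boot all_order all_algebra.
From mathcomp Require Import all_classical all_reals all_analysis.
From mathcomp Require Import measurable_realfun zify ring lra.

Set Implicit Arguments.
Unset Strict Implicit.
Unset Printing Implicit Defensive.

Import Order.TTheory GRing.Theory Num.Theory.
Import numFieldNormedType.Exports.

Local Open Scope classical_set_scope.
Local Open Scope ring_scope.


(** * Conditioning on a sub-sigma-algebra *)

(** The noise has only second moments, so multiplying a square-integrable vector by w_k may leave
    L2. Two dual facts prevent this, and both rest on the conditional second moment of w_k being
    deterministic: w_k X is square-integrable when X is F_k-measurable, which carries the state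
    forward, and E_k[w_k Y] is square-integrable for every Y in L2, which carries the costate
    backward.

    A conditional expectation is a chosen version, linear only almost surely. Its linearity is
    therefore used only inside integrals, after one conditional expectation has been moved off
    against an F_s-measurable factor.

    For each event of F_t separately, the perturbed cost is a quadratic polynomial in a real scale.
    The vanishing of its linear coefficient in every direction yields H_k = 0 by choosing as
    direction H_k itself, at the single time k. For the second player H_k contains E_k X_k, E_k u_k
    and E_k v_k where the stationary condition has X_k, u_k and v_k; the two are exchanged by
    comparing their integrals against F_k-measurable vectors. *)

Section sub_sigma_algebra.
Context d (T : measurableType d) (R : realType) (P : probability T R).
Variable G : set (set T).
Hypothesis GT : <<s G >> `<=` d.-measurable.

Local Notation T' := (g_sigma_algebraType G).

Lemma measurable_fun_sub d' (U : measurableType d') (f : T -> U) :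
  measurable_fun [set: T'] f -> measurable_fun [set: T] f.
Proof.
move=> mf _ B mB; rewrite setTI; apply: GT.
by have := mf (@measurableT _ T') B mB; rewrite setTI.
Qed.

Let GsetT : <<s G >> [set: T].
Proof. exact: (@measurableT _ T'). Qed.

Import HBNNSimple.

(** The level sets of [h] are events of [G], so the integral depends on [X] only through its
    integrals over such events. This is how equality on events extends to equality against
    [G]-measurable factors. *)
Lemma nnsfun_integralM (X : T -> R) (h : {nnsfun T' >-> R}) :
  measurable_fun [set: T] X -> (forall x, 0 <= X x) ->
  (\int[P]_x (h x * X x)%:E =
   \sum_(r \in range h) r%:E * \int[P]_(x in h @^-1` [set r]) (X x)%:E)%E.
Proof.
move=> mX X0.
have mh r : measurable (h @^-1` [set r] : set T).
  by apply: GT; exact: (measurable_funPTI h).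
have mhi r : measurable_fun [set: T] (\1_(h @^-1` [set r]) : T -> R).
  exact: measurable_indic.
transitivity (\int[P]_x (\sum_(r \in range h)
    (r * \1_(h @^-1` [set r]) x * X x)%:E))%E.
  apply: eq_integral => x _; rewrite fsumEFin// /= [in LHS]fimfunE.
  by rewrite -mulr_fsuml.
rewrite ge0_integral_fsum//; last 2 first.
  - move=> r; apply/measurable_EFinP.
    by do 2 apply: measurable_funM => //.
  - move=> r x _; rewrite lee_fin mulr_ge0//.
    by have := nnfun_muleindic_ge0 h r x; rewrite -EFinM lee_fin.
apply: eq_fsbigr => r /[!inE] -[z _ <-].
under eq_integral do rewrite -mulrA EFinM.
rewrite ge0_integralZl//; last 3 first.
  - by apply/measurable_EFinP; apply: measurable_funM.
  - by move=> x _; rewrite lee_fin mulr_ge0.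
  - by rewrite lee_fin.
congr (_ * _)%E; rewrite [RHS]integral_mkcond.
apply: eq_integral => x _; rewrite patchE indicE.
by case: (x \in _); rewrite ?mul1r ?mul0r.
Qed.

(** Approximate [xi] from below by simple functions measurable for [G] and use monotone convergence.
    By nonnegativity both sides may be infinite, so no integrability is asked. *)
Lemma ge0_integralM_eq (X Y xi : T -> R) :
  measurable_fun [set: T] X -> (forall x, 0 <= X x) ->
  measurable_fun [set: T] Y -> (forall x, 0 <= Y x) ->
  (forall A, <<s G >> A ->
    (\int[P]_(x in A) (X x)%:E = \int[P]_(x in A) (Y x)%:E)%E) ->
  measurable_fun [set: T'] xi -> (forall x, 0 <= xi x) ->
  (\int[P]_x (xi x * X x)%:E = \int[P]_x (xi x * Y x)%:E)%E.
Proof.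
move=> mX X0 mY Y0 XY mxi xi0.
have mxi' : measurable_fun [set: T'] (EFin \o xi) by exact/measurable_EFinP.
pose h := nnsfun_approx (@measurableT _ T') mxi'.
have limE (Z : T -> R) : measurable_fun [set: T] Z -> (forall x, 0 <= Z x) ->
    (\int[P]_x (xi x * Z x)%:E =
     limn (fun n => \int[P]_x (h n x * Z x)%:E))%E.
  move=> mZ Z0; rewrite -monotone_convergence//.
  - apply: eq_integral => x _; apply/esym/cvg_lim => //.
    under eq_fun do rewrite EFinM; rewrite EFinM; apply: cvgeZr => //.
    by apply: (cvg_nnsfun_approx (@measurableT _ T') mxi') => // z _; rewrite lee_fin.
  - move=> n; apply/measurable_EFinP; apply: measurable_funM => //.
    by apply: measurable_fun_sub; exact: measurable_funP.
  - by move=> n x _; rewrite lee_fin mulr_ge0.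
  - move=> x _ a b ab; rewrite lee_fin ler_wpM2r//.
    by have /lefP/(_ x) := nd_nnsfun_approx (@measurableT _ T') mxi' ab.
rewrite (limE X)// (limE Y)//; congr (limn _); apply/funext => n.
rewrite !nnsfun_integralM//; apply: eq_fsbigr => r _; rewrite XY//.
exact: (measurable_funPTI (h n)).
Qed.

(** The charge with density [X], restricted to [G], is absolutely continuous with respect to the
    restriction of [P]; its Radon-Nikodym derivative is the conditional expectation. *)
Lemma condexp_exists (X : T -> R) : P.-integrable [set: T] (EFin \o X) ->
  exists Y : T -> R, [/\ P.-integrable [set: T] (EFin \o Y),
    measurable_fun [set: T'] Y &
    forall A, <<s G >> A ->
      (\int[P]_(x in A) (Y x)%:E = \int[P]_(x in A) (X x)%:E)%E].
Proof.
move=> iX.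
(* Restriction to the sub-sigma-algebra is realized as a pushforward along the identity into the
   coarser measurable space. *)
have mid : measurable_fun [set: T] (idfun : T -> T').
  by move=> _ B mB; rewrite setTI; exact: GT.
pose id' : {mfun T >-> T'} := HB.pack (idfun : T -> T')
  (isMeasurableFun.Build _ _ _ _ _ mid).
pose mu' : probability T' R := distribution P id'.
pose nu : {charge set T' -> \bar R} :=
  measure_function_pushforward__canonical__charge_Charge (induced_charge iX) mid.
have numu : nu `<< mu'.
  apply/null_content_dominatesP => A mA muA.
  rewrite /nu /= /pushforward /induced_charge/=.
  apply: null_set_integral => //.
  - exact: GT.
  - by apply: measurable_funTS; apply: measurable_int iX.
pose f := Radon_Nikodym nu mu'.
have ffin x : f x \is a fin_num by exact: Radon_Nikodym_fin_num.
have fE : EFin \o (fine \o f) = f by apply/funext => x /=; rewrite fineK.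
have if' : mu'.-integrable [set: T'] f by exact: Radon_Nikodym_integrable.
have mf : measurable_fun [set: T'] (fine \o f).
  by apply/measurable_EFinP; rewrite fE; exact: measurable_int if'.
have iY : P.-integrable [set: T] (EFin \o (fine \o f)).
  rewrite fE; apply/integrableP; split.
    by rewrite -fE; apply/measurable_EFinP; exact: measurable_fun_sub.
  move/integrableP : if' => [mf' +]; rewrite ge0_integral_pushforward//.
  exact: measurableT_comp.
exists (fine \o f); split => // A GA.
transitivity (nu A); last by [].
rewrite (Radon_Nikodym_integral numu)// integral_pushforward//; last first.
  by rewrite fE in iY; exact: (integrableS measurableT (GT GA) (@subsetT _ _) iY).
transitivity (\int[P]_(x in A) f x)%E; last by [].
by apply: eq_integral => x _ /=; rewrite fineK.
Qed.


Let integrableSub (f : T -> R) A : P.-integrable [set: T] (EFin \o f) ->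
  <<s G >> A -> P.-integrable A (EFin \o f).
Proof. by move=> iF /GT mA; exact: integrableS iF. Qed.

Section equal_integrals.
Variables X Y : T -> R.
Hypotheses (iX : P.-integrable [set: T] (EFin \o X))
           (iY : P.-integrable [set: T] (EFin \o Y)).
Hypothesis XY : forall A, <<s G >> A ->
  (\int[P]_(x in A) (X x)%:E = \int[P]_(x in A) (Y x)%:E)%E.

Let mX : measurable_fun [set: T] X.
Proof. by apply/measurable_EFinP; exact: measurable_int iX. Qed.

Let mY : measurable_fun [set: T] Y.
Proof. by apply/measurable_EFinP; exact: measurable_int iY. Qed.

(* Shifting both sides by |X| + |Y| reduces to nonnegative functions. *)
Let ge0_RintegralM_eq (xi : T -> R) :
  measurable_fun [set: T'] xi -> (forall x, 0 <= xi x) ->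
  P.-integrable [set: T] (EFin \o (fun x => xi x * X x)) ->
  P.-integrable [set: T] (EFin \o (fun x => xi x * Y x)) ->
  \int[P]_x (xi x * X x) = \int[P]_x (xi x * Y x).
Proof.
move=> mxi xi0 ixX ixY.
pose Z x := `|X x| + `|Y x|.
have iZ : P.-integrable [set: T] (EFin \o Z).
  by apply: (integrableD measurableT (integrable_norm iX) (integrable_norm iY)).
have ixZ : P.-integrable [set: T] (EFin \o (fun x => xi x * Z x)).
  apply: eq_integrable (integrableD measurableT (integrable_norm ixX)
    (integrable_norm ixY)) => // x _.
  by rewrite /= /Z mulrDr !normrM (ger0_norm (xi0 x)) EFinD.
have mZ : measurable_fun [set: T] Z.
  by apply/measurable_EFinP; exact: measurable_int iZ.
have shift (V : T -> R) A : P.-integrable [set: T] (EFin \o V) -> <<s G >> A ->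
    (\int[P]_(x in A) (V x + Z x)%:E =
     \int[P]_(x in A) (V x)%:E + \int[P]_(x in A) (Z x)%:E)%E.
  move=> iV GA; under eq_integral do rewrite EFinD.
  by rewrite integralD_EFin//; [exact: GT|exact: integrableSub|exact: integrableSub].
have : (\int[P]_x (xi x * (X x + Z x))%:E = \int[P]_x (xi x * (Y x + Z x))%:E)%E.
  apply: ge0_integralM_eq => //.
  - exact: measurable_funD.
  - by move=> x; rewrite /Z addrA addr_ge0// -lerBlDl sub0r -normrN ler_norm.
  - exact: measurable_funD.
  - by move=> x; rewrite /Z addrCA addr_ge0// -lerBlDl sub0r -normrN ler_norm.
  - by move=> A GA; rewrite !shift// XY.
move=> /(congr1 fine); rewrite -!/(Rintegral _ _ _).
under eq_Rintegral do rewrite mulrDr.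
under [in RHS]eq_Rintegral do rewrite mulrDr.
by rewrite !RintegralD// => /addIr.
Qed.

(** This is the pull-out property in integrated form. The signed weight [xA], which is [xi] cut off
    outside [A], is the difference of the nonnegative weights [xA + |xA|] and [|xA|], and both stay
    integrable against [X] and [Y]. *)
Lemma RintegralM_eq (xi : T -> R) (A : set T) :
  measurable_fun [set: T'] xi ->
  P.-integrable [set: T] (EFin \o (fun x => xi x * X x)) ->
  P.-integrable [set: T] (EFin \o (fun x => xi x * Y x)) ->
  <<s G >> A ->
  \int[P]_(x in A) (xi x * X x) = \int[P]_(x in A) (xi x * Y x).
Proof.
move=> mxi ixX ixY GA.
pose xA x := xi x * \1_A x.
have mxA : measurable_fun [set: T'] xA.
  by apply: measurable_funM => //; exact: (@measurable_indic _ T').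
have xAE (V : T -> R) : (fun x => xi x * V x) \_ A = fun x => xA x * V x.
  apply/funext => x; rewrite patchE /xA indicE.
  by case: (x \in A); rewrite ?mulr1// mulr0 mul0r.
have ixA (V : T -> R) : P.-integrable [set: T] (EFin \o (fun x => xi x * V x)) ->
    P.-integrable [set: T] (EFin \o (fun x => xA x * V x)).
  move=> iV; rewrite -xAE -restrict_EFin; apply/(integrable_mkcond _ (GT GA)).
  exact: integrableSub.
rewrite [LHS]Rintegral_mkcond [RHS]Rintegral_mkcond !xAE.
have inA (V : T -> R) : P.-integrable [set: T] (EFin \o (fun x => xA x * V x)) ->
    measurable_fun [set: T] V ->
    P.-integrable [set: T] (EFin \o (fun x => `|xA x| * V x)).
  move=> iV mV; apply: le_integrable iV => //.
    apply/measurable_EFinP; apply: measurable_funM => //.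
    by apply: measurableT_comp => //; exact: measurable_fun_sub.
  by move=> x _; rewrite /= lee_fin !normrM !normr_id lexx.
have split (V : T -> R) : P.-integrable [set: T] (EFin \o (fun x => xA x * V x)) ->
    measurable_fun [set: T] V ->
    \int[P]_x (xA x * V x) =
    \int[P]_x ((xA x + `|xA x|) * V x) - \int[P]_x (`|xA x| * V x).
  move=> iV mV; under [X in _ = X - _]eq_Rintegral do rewrite mulrDl.
  by rewrite RintegralD ?addrK//; exact: inA.
have iDA (V : T -> R) : P.-integrable [set: T] (EFin \o (fun x => xA x * V x)) ->
    measurable_fun [set: T] V ->
    P.-integrable [set: T] (EFin \o (fun x => (xA x + `|xA x|) * V x)).
  move=> iV mV.
  apply: eq_integrable (integrableD measurableT iV (inA V iV mV)) => // x _.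
  by rewrite /= -EFinD mulrDl.
have mN : measurable_fun [set: T'] (fun x => `|xA x|) by exact: measurableT_comp.
rewrite !split//; try exact: ixA.
congr (_ - _); apply: ge0_RintegralM_eq => //;
  try by [apply: iDA => //; exact: ixA|apply: inA => //; exact: ixA].
- exact: measurable_funD.
- by move=> x; rewrite -lerBlDl sub0r -normrN ler_norm.
Qed.

End equal_integrals.

Lemma measurable_Lfun (p : \bar R) (f : T -> R) :
  f \in Lfun P p -> measurable_fun [set: T] f.
Proof. by move=> /sub_Lfun_mfun; rewrite inE. Qed.

Lemma Lfun2_sqr_lty (f : T -> R) : measurable_fun [set: T] f ->
  (\int[P]_x (f x ^+ 2)%:E < +oo)%E -> f \in Lfun P 2%:E.
Proof.
move=> mf foo; rewrite inE; apply/andP; split; rewrite inE//=.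
rewrite /finite_norm unlock poweR_lty//.
apply: le_lt_trans foo; rewrite le_eqVlt; apply/orP; left; apply/eqP.
by apply: eq_integral => x _ /=; rewrite powR_mulrn// -normrX ger0_norm ?sqr_ge0.
Qed.

Let integral_sqr_cst_ge0 (W : T -> R) (C : R) :
  (forall A, <<s G >> A ->
    (\int[P]_(x in A) (W x ^+ 2)%:E = \int[P]_(x in A) C%:E)%E) -> 0 <= C.
Proof.
move=> /(_ _ GsetT); rewrite integral_cst//.
rewrite (_ : _ * _ = C%:E)%E; last first.
  by rewrite -[RHS]mule1; congr (_ * _)%E; exact: probability_setT.
rewrite -lee_fin => <-.
by apply: integral_ge0 => x _; rewrite lee_fin sqr_ge0.
Qed.

(** Conditionally on [G] the square of [W] averages to [C], and the [G]-measurable weight [xi ^+ 2]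
    pulls out. Both sides may be infinite; when [xi] is square-integrable, so is [W * xi]. *)
Lemma ge0_integral_sqrM (W xi : T -> R) (C : R) :
  W \in Lfun P 2%:E ->
  (forall A, <<s G >> A ->
    (\int[P]_(x in A) (W x ^+ 2)%:E = \int[P]_(x in A) C%:E)%E) ->
  measurable_fun [set: T'] xi ->
  (\int[P]_x ((W x * xi x) ^+ 2)%:E = C%:E * \int[P]_x (xi x ^+ 2)%:E)%E.
Proof.
move=> W2 WC mxi.
have mW := measurable_Lfun W2.
have C0 : 0 <= C by exact: (integral_sqr_cst_ge0 WC).
under eq_integral do rewrite exprMn mulrC.
rewrite (@ge0_integralM_eq _ (cst C))//; last 4 first.
- exact: measurable_funX.
- by move=> x; rewrite sqr_ge0.
- exact: measurable_funX.
- by move=> x; rewrite sqr_ge0.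
rewrite -ge0_integralZl//; last 2 first.
- by apply/measurable_EFinP; apply: measurable_funX; exact: measurable_fun_sub.
- by move=> x _; rewrite lee_fin sqr_ge0.
by apply: eq_integral => x _; rewrite /= mulrC EFinM.
Qed.

(* Testing against the truncations of Y gives, by Young's inequality, a bound
   on their L2-norms that does not depend on the truncation level. *)
Lemma Lfun2_condexpM (W X Y : T -> R) (C : R) :
  W \in Lfun P 2%:E ->
  (forall A, <<s G >> A ->
    (\int[P]_(x in A) (W x ^+ 2)%:E = \int[P]_(x in A) C%:E)%E) ->
  X \in Lfun P 2%:E ->
  P.-integrable [set: T] (EFin \o Y) -> measurable_fun [set: T'] Y ->
  (forall A, <<s G >> A ->
    (\int[P]_(x in A) (Y x)%:E = \int[P]_(x in A) (W x * X x)%:E)%E) ->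
  Y \in Lfun P 2%:E.
Proof.
move=> W2 WC X2 iY mY YWX.
have iWX : P.-integrable [set: T] (EFin \o (fun x => W x * X x)).
  by apply/Lfun1_integrable; exact: Lfun2_mul_Lfun1.
have C0 : 0 <= C by exact: (integral_sqr_cst_ge0 WC).
have mYT := measurable_fun_sub mY.
pose S (n : nat) : set T' := [set x | `|Y x| <= n%:R].
have mS n : measurable (S n).
  rewrite -[S n]setTI; apply:
    (@measurable_fun_le _ _ _ setT (fun x : T' => `|Y x|) (cst n%:R)) => //.
  exact: measurableT_comp.
pose xi n x := Y x * \1_(S n) x.
have mxi n : measurable_fun [set: T'] (xi n).
  by apply: measurable_funM => //; exact: (@measurable_indic _ T').
have mxiT n := measurable_fun_sub (mxi n).
have bxi n : [bounded xi n x | x in [set: T]].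
  exists n%:R; split; first exact: num_real.
  move=> M nM x _; apply: (le_trans _ (ltW nM)).
  rewrite /xi indicE; case: (boolP (x \in S n)) => xS; last by rewrite mulr0 normr0.
  by rewrite mulr1; move: xS; rewrite inE.
have ixi n (V : T -> R) : P.-integrable [set: T] (EFin \o V) ->
    P.-integrable [set: T] (EFin \o (fun x => xi n x * V x)).
  by move=> iV; apply: eq_integrable (integrableMr measurableT (mxiT n) (bxi n) iV).
have xiY n x : xi n x * Y x = xi n x ^+ 2.
  by rewrite /xi indicE; case: (x \in S n); rewrite ?mulr1 ?mulr0 ?mul0r ?expr0n.
have ixi2 n : P.-integrable [set: T] (EFin \o (fun x => xi n x ^+ 2)).
  by apply: eq_integrable (ixi n Y iY) => // x _; rewrite /= xiY.
have iX2 := Lfun2_integrable_sqr X2.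
have iWxi2 n : P.-integrable [set: T] (EFin \o (fun x => (W x * xi n x) ^+ 2)).
  apply/integrableP; split.
    apply/measurable_EFinP; apply: measurable_funX; apply: measurable_funM => //.
    exact: measurable_Lfun W2.
  under eq_integral do rewrite /= ger0_norm ?sqr_ge0//.
  rewrite (ge0_integral_sqrM W2 WC (mxi n)) lte_mul_pinfty//.
  exact: (integrable_lty measurableT (ixi2 n)).
(* The weight in Young's inequality. Adding 1 keeps it positive when [C] is 0, while C / (2c) stays
   below 1/2, so that half of [I] can be absorbed by the left side. *)
pose c := C + 1.
have c0 : 0 < c by rewrite ltr_wpDl.
pose K := c * \int[P]_x (X x ^+ 2).
have xiK n : (\int[P]_x (xi n x ^+ 2)%:E <= K%:E)%E.
  have fin2 : (\int[P]_x (xi n x ^+ 2)%:E)%E \is a fin_num.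
    exact: (integrable_fin_num measurableT (ixi2 n)).
  rewrite -(fineK fin2) lee_fin -/(Rintegral _ _ _).
  set I := Rintegral _ _ _.
  have E1 : I = \int[P]_x (xi n x * (W x * X x)).
    rewrite -(RintegralM_eq iY iWX YWX (mxi n) (ixi n Y iY) (ixi n _ iWX) GsetT).
    by apply: eq_Rintegral => x _; rewrite xiY.
  have E2 : \int[P]_x ((W x * xi n x) ^+ 2) = C * I.
    by rewrite /Rintegral (ge0_integral_sqrM W2 WC (mxi n)) fineM.
  have : I <= (2 * c)^-1 * (C * I) + c / 2 * \int[P]_x (X x ^+ 2).
    have i1 : P.-integrable [set: T]
        (EFin \o (fun x => (2 * c)^-1 * (W x * xi n x) ^+ 2)).
      exact: (integrableZl measurableT _ (iWxi2 n)).
    have i2 : P.-integrable [set: T] (EFin \o (fun x => c / 2 * X x ^+ 2)).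
      exact: (integrableZl measurableT _ iX2).
    rewrite -E2 {1}E1 -!RintegralZl// -RintegralD//.
    apply: le_Rintegral => //.
    - exact: ixi.
    - exact: (integrableD measurableT i1 i2).
    move=> x _.
    have -> : xi n x * (W x * X x) =
      (W x * xi n x) * X x by rewrite mulrA (mulrC (xi n x)).
    move: (W x * xi n x) (X x) => a b.
    rewrite -subr_ge0.
    have -> : (2 * c)^-1 * a ^+ 2 + c / 2 * b ^+ 2 - a * b =
      (2 * c)^-1 * (a - c * b) ^+ 2.
      by field; rewrite gt_eqF.
    by rewrite mulr_ge0 ?sqr_ge0// invr_ge0 mulr_ge0// ltW.
  have I0 : 0 <= I by apply: Rintegral_ge0 => x _; rewrite sqr_ge0.
  have : (2 * c)^-1 * (C * I) <= I / 2.
    rewrite invfM -!mulrA (mulrC I) ler_wpM2l ?invr_ge0// mulrA ler_piMl//.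
    by rewrite mulrC ler_pdivrMr// mul1r /c lerDl.
  rewrite /K; set J := Rintegral _ _ _; lra.
apply: Lfun2_sqr_lty => //.
apply: (@le_lt_trans _ _ K%:E); last exact: ltry.
(* At each point the truncation is inactive once the level reaches |Y x|; monotone convergence then
   passes the uniform bound [K] to the limit. *)
have -> : (\int[P]_x (Y x ^+ 2)%:E =
           \int[P]_x limn (fun n => (xi n x ^+ 2)%:E))%E.
  apply: eq_integral => x _; apply/esym/cvg_lim => //.
  apply: cvg_near_cst; near=> n; congr (_%:E); congr (_ ^+ 2).
  rewrite /xi indicE mem_set ?mulr1//= /S /=.
  apply: ltW; apply: (lt_le_trans (truncnS_gt _)).
  by rewrite ler_nat; near: n; exact: nbhs_infty_ge.
have xind x : {homo (fun n => (xi n x ^+ 2)%:E) : m n / (m <= n)%N >-> (m <= n)%E}.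
  move=> m n mn; rewrite lee_fin /xi !indicE.
  case: (boolP (x \in S m)) => xm; last by rewrite mulr0 expr0n/= sqr_ge0.
  rewrite (mem_set (_ : S n x)) ?mulr1//.
  by move: xm; rewrite inE /S/= => /le_trans; apply; rewrite ler_nat.
have mxi2 n : measurable_fun [set: T] (fun x => (xi n x ^+ 2)%:E).
  by apply/measurable_EFinP; apply: measurable_funX.
rewrite monotone_convergence//; last by move=> n x _; rewrite lee_fin sqr_ge0.
apply: lime_le; last exact: nearW.
apply: ereal_nondecreasing_is_cvgn => m n mn; apply: ge0_le_integral => //.
- by move=> x _; rewrite lee_fin sqr_ge0.
- by move=> x _; exact: xind.
Unshelve. all: by end_near. Qed.

End sub_sigma_algebra.


(** * Square-integrable random vectors *)

Lemma dotE (R : realType) (r : nat) (a b : 'cV[R]_r) :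
  dot a b = \sum_i a i 0 * b i 0.
Proof. by rewrite /dot mxE; apply: eq_bigr => i _; rewrite mxE. Qed.

Lemma dotC (R : realType) (r : nat) (a b : 'cV[R]_r) : dot a b = dot b a.
Proof. by rewrite !dotE; apply: eq_bigr => i _; rewrite mulrC. Qed.

Lemma dotDl (R : realType) (r : nat) (a b c : 'cV[R]_r) :
  dot (a + b) c = dot a c + dot b c.
Proof. by rewrite /dot linearD/= mulmxDl mxE. Qed.

Lemma dotZl (R : realType) (r : nat) (k : R) (a b : 'cV[R]_r) :
  dot (k *: a) b = k * dot a b.
Proof. by rewrite /dot linearZ/= -scalemxAl mxE. Qed.

Lemma dot_mx (R : realType) (r c : nat) (M : 'M[R]_(r, c)) a b :
  dot (M *m a) b = dot a (M^T *m b).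
Proof. by rewrite /dot trmx_mul mulmxA. Qed.

Lemma bilE (R : realType) (r c : nat) (a : 'cV[R]_r) (M : 'M[R]_(r, c)) b :
  bil a M b = dot a (M *m b).
Proof. by rewrite /bil /dot mulmxA. Qed.

Section random_vectors.
Context {d : measure_display} {T : measurableType d} {R : realType}.
Variable P : probability T R.
Context {p : nat}.
Variable w : nat -> T -> 'cV[R]_p.

Local Notation E := (condexp P w).
Local Notation EM := (condexp_mx P w).
Local Notation rv r := (T -> 'cV[R]_r).
Local Notation F k := <<s noise_gen w k >>.

(** Square integrability without adaptedness. Costates are tracked only in this class; the
    conditional expectations applied to them restore adaptedness. *)
Definition L2 (r : nat) (X : rv r) : Prop :=
  forall i, (fun x => X x i 0) \in Lfun P 2%:E.

Definition mulmxf (r c : nat) (M : 'M[R]_(r, c)) (X : rv c) : rv r :=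
  fun x => M *m X x.

Definition noise_scale (r : nat) (k : nat) (i : 'I_p) (X : rv r) : rv r :=
  fun x => w k x i 0 *: X x.

(** With [A] ranging over the events of F_s, these numbers encode the conditional expectation of the
    dot product given F_s. *)
Definition inner (A : set T) (r : nat) (X Y : rv r) : R :=
  \int[P]_(x in A) dot (X x) (Y x).


Lemma Lfun2D (f g : T -> R) : f \in Lfun P 2%:E -> g \in Lfun P 2%:E ->
  (fun x => f x + g x) \in Lfun P 2%:E.
Proof. by move=> f2 g2; apply: (Lfun_addr_closed _ (lee1n 2)).2. Qed.

Lemma Lfun2Z (c : R) (f : T -> R) : f \in Lfun P 2%:E ->
  (fun x => c * f x) \in Lfun P 2%:E.
Proof.
move=> f2; rewrite (_ : (fun x => _) = c \o* f); first by apply: Lfun_scale;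
  rewrite ?ler1n.
by apply/funext => x /=; rewrite mulrC.
Qed.

Lemma Lfun2_sum (I : Type) (s : seq I) (f : I -> T -> R) :
  (forall i, f i \in Lfun P 2%:E) -> (fun x => \sum_(i <- s) f i x) \in Lfun P 2%:E.
Proof.
move=> f2; elim: s => [|i s ih].
  by under eq_fun do rewrite big_nil; exact: Lfun_cst.
by under eq_fun do rewrite big_cons; apply: Lfun2D.
Qed.

Section L2_closure.
Variables (r : nat).
Implicit Types X Y : rv r.

Lemma l2F_L2 k X : l2F P w k X -> L2 X.
Proof. by move=> X2 i; case: (X2 i). Qed.

Lemma L2D X Y : L2 X -> L2 Y -> L2 (X + Y).
Proof.
move=> X2 Y2 i; rewrite (_ : (fun x => _) = (fun x => X x i 0 + Y x i 0)).
  exact: Lfun2D.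
by apply/funext => x; rewrite !fctE mxE.
Qed.

Lemma L2Z c X : L2 X -> L2 (c *: X).
Proof.
move=> X2 i; rewrite (_ : (fun x => _) = (fun x => c * X x i 0)).
  exact: Lfun2Z.
by apply/funext => x; rewrite !fctE mxE.
Qed.

Lemma L2_cst c : L2 (cst c : rv r).
Proof. by move=> i; exact: Lfun_cst. Qed.

Lemma L2_sum (I : Type) (s : seq I) (f : I -> rv r) :
  (forall i, L2 (f i)) -> L2 (\sum_(i <- s) f i).
Proof. by move=> f2; elim/big_ind: _ => //; [exact: L2_cst|exact: L2D]. Qed.

Lemma L2_mulmxf c (M : 'M[R]_(c, r)) X : L2 X -> L2 (mulmxf M X).
Proof.
move=> X2 i; under eq_fun do rewrite mxE.
by apply: Lfun2_sum => j; exact: Lfun2Z.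
Qed.

Lemma l2FD k X Y : l2F P w k X -> l2F P w k Y -> l2F P w k (X + Y).
Proof.
move=> X2 Y2 i; split; last by apply: L2D; exact: l2F_L2.
rewrite (_ : (fun x => _) = (fun x => X x i 0 + Y x i 0)).
  by apply: measurable_funD; [case: (X2 i)|case: (Y2 i)].
by apply/funext => x; rewrite !fctE mxE.
Qed.

Lemma l2FZ k c X : l2F P w k X -> l2F P w k (c *: X).
Proof.
move=> X2 i; split; last by apply: L2Z; exact: l2F_L2.
rewrite (_ : (fun x => _) = (fun x => c * X x i 0)).
  by apply: measurable_funM => //; case: (X2 i).
by apply/funext => x; rewrite !fctE mxE.
Qed.

Lemma l2F_cst k c : l2F P w k (cst c : rv r).
Proof. by move=> i; split; [exact: measurable_cst|exact: L2_cst]. Qed.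

Lemma l2F_sum k (I : Type) (s : seq I) (f : I -> rv r) :
  (forall i, l2F P w k (f i)) -> l2F P w k (\sum_(i <- s) f i).
Proof. by move=> f2; elim/big_ind: _ => //; [exact: l2F_cst|exact: l2FD]. Qed.

Lemma l2F_mulmxf k c (M : 'M[R]_(c, r)) X : l2F P w k X -> l2F P w k (mulmxf M X).
Proof.
move=> X2 i; split; last by apply: L2_mulmxf; exact: l2F_L2.
rewrite (_ : (fun x => _) = (fun x => \sum_j M i j * X x j 0)).
  by apply: measurable_sum => j; apply: measurable_funM => //; case: (X2 j).
by apply/funext => x; rewrite mxE.
Qed.

Lemma noise_gen_mono k l : (k <= l)%N -> F k `<=` F l.
Proof.
move=> kl; apply: sub_sigma_algebra2 => A [j [i [jk HA]]].
by exists j, i; split => //; exact: leq_trans kl.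
Qed.

Lemma F_measurable_mono k l (f : T -> R) : (k <= l)%N ->
  F_measurable w k f -> F_measurable w l f.
Proof. by move=> kl mf _ B mB; apply: (noise_gen_mono kl); exact: mf. Qed.

Lemma l2F_mono k l X : (k <= l)%N -> l2F P w k X -> l2F P w l X.
Proof.
by move=> kl X2 i; have [mX ?] := X2 i; split => //; exact: F_measurable_mono mX.
Qed.

End L2_closure.

Section inner_product.
Variable A : set T.
Hypothesis mA : measurable A.

Let integrableA (f : T -> R) : P.-integrable [set: T] (EFin \o f) ->
  P.-integrable A (EFin \o f).
Proof. by move=> fi; exact: integrableS fi. Qed.

Lemma integrable_dot r (X Y : rv r) : L2 X -> L2 Y ->
  P.-integrable [set: T] (EFin \o (fun x => dot (X x) (Y x))).
Proof.
move=> X2 Y2; rewrite (_ : EFin \o _ =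
    (fun x => \sum_i (X x i 0 * Y x i 0)%R%:E)%E); last first.
  by apply/funext => x; rewrite /= dotE sumEFin.
by apply: integrable_sum => // i _; apply/Lfun1_integrable; exact: Lfun2_mul_Lfun1.
Qed.

Lemma innerE r (X Y : rv r) : L2 X -> L2 Y ->
  inner A X Y = \sum_i \int[P]_(x in A) (X x i 0 * Y x i 0).
Proof.
move=> X2 Y2; rewrite /inner.
under eq_Rintegral do rewrite dotE.
rewrite /Rintegral; under eq_integral do rewrite -sumEFin.
have iXY i : P.-integrable A (EFin \o (fun x => X x i 0 * Y x i 0)).
  by apply: integrableA; apply/Lfun1_integrable; exact: Lfun2_mul_Lfun1.
rewrite integral_sum//= -sum_fine// => i _.
exact: (integrable_fin_num mA (iXY i)).
Qed.

Lemma innerC r (X Y : rv r) : inner A X Y = inner A Y X.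
Proof. by apply: eq_Rintegral => x _; rewrite dotC. Qed.

Lemma innerDl r (X Y Z : rv r) : L2 X -> L2 Y -> L2 Z ->
  inner A (X + Y) Z = inner A X Z + inner A Y Z.
Proof.
move=> X2 Y2 Z2; rewrite /inner -RintegralD//.
- by apply: eq_Rintegral => x _; rewrite fctE dotDl.
- exact/integrableA/integrable_dot.
- exact/integrableA/integrable_dot.
Qed.

Lemma innerDr r (X Y Z : rv r) : L2 X -> L2 Y -> L2 Z ->
  inner A X (Y + Z) = inner A X Y + inner A X Z.
Proof. by move=> X2 Y2 Z2; rewrite innerC innerDl// !(innerC X). Qed.

Lemma innerZl r c (X Y : rv r) : L2 X -> L2 Y ->
  inner A (c *: X) Y = c * inner A X Y.
Proof.
move=> X2 Y2; rewrite /inner -RintegralZl//.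
  by apply: eq_Rintegral => x _; rewrite fctE dotZl.
exact/integrableA/integrable_dot.
Qed.

Lemma innerZr r c (X Y : rv r) : L2 X -> L2 Y ->
  inner A X (c *: Y) = c * inner A X Y.
Proof. by move=> X2 Y2; rewrite innerC innerZl// innerC. Qed.

Lemma inner0l r (X : rv r) : inner A (cst 0) X = 0.
Proof.
transitivity (\int[P]_(x in A) (0 : R)); last by rewrite Rintegral_cst ?mul0r.
by apply: eq_Rintegral => x _; rewrite dotE big1// => i _; rewrite mxE mul0r.
Qed.

Lemma inner0r r (X : rv r) : inner A X (cst 0) = 0.
Proof. by rewrite innerC inner0l. Qed.

Lemma inner_sumr r (I : Type) (s : seq I) (X : rv r) (f : I -> rv r) : L2 X ->
  (forall i, L2 (f i)) ->
  inner A X (\sum_(i <- s) f i) = \sum_(i <- s) inner A X (f i).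
Proof.
move=> X2 f2; elim: s => [|i s ih]; first by rewrite !big_nil; exact: inner0r.
by rewrite !big_cons innerDr ?ih//; exact: L2_sum.
Qed.

Lemma inner_suml r (I : Type) (s : seq I) (X : rv r) (f : I -> rv r) : L2 X ->
  (forall i, L2 (f i)) ->
  inner A (\sum_(i <- s) f i) X = \sum_(i <- s) inner A (f i) X.
Proof.
by move=> X2 f2; rewrite innerC inner_sumr//; apply: eq_bigr => i _; rewrite innerC.
Qed.

Lemma inner_mulmxf r c (M : 'M[R]_(r, c)) X Y :
  inner A (mulmxf M X) Y = inner A X (mulmxf M^T Y).
Proof. by apply: eq_Rintegral => x _; rewrite dot_mx. Qed.

End inner_product.

(** * Conditional expectations along the noise filtration *)

Section filtration.
Variables (N : nat) (Delta : nat -> 'M[R]_p).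
Hypothesis mdw : martingale_difference P w N Delta.

Lemma noise_Lfun2 k i : (k < N)%N -> (fun x => w k x i 0) \in Lfun P 2%:E.
Proof. by move=> /mdw[]. Qed.

(** F_k is generated by the noise strictly before [k], and the noise is known to be measurable at
    times below [N]; hence [k = N] is still allowed. *)
Lemma filtration_measurable k : (k <= N)%N -> F k `<=` d.-measurable.
Proof.
move=> kN; apply: smallest_sub; first exact: sigma_algebra_measurable.
move=> A [l [i [lk [B mB <-]]]].
exact: (measurable_Lfun (noise_Lfun2 i (leq_trans lk kN))).
Qed.

Lemma noise_F_measurable k l i : (l < k)%N -> F_measurable w k (fun x => w l x i 0).
Proof.
move=> lk _ B mB; apply: sub_sigma_algebra; exists l, i; split => //.
by exists B.
Qed.

Lemma condexpP k (X : T -> R) : (k <= N)%N -> P.-integrable [set: T] (EFin \o X) ->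
  is_condexp P w k X (E k X).
Proof.
move=> kN iX; rewrite /condexp.
have [Y [iY mY XY]] := condexp_exists (filtration_measurable kN) iX.
by have /(xgetPex (cst 0)) : exists Y, [set Y | is_condexp P w k X Y] Y by exists Y;
  split.
Qed.

(** The diagonal of the conditional covariance, put in the integrated form required by
    [ge0_integral_sqrM] and [Lfun2_condexpM]. *)
Lemma noise_second_moment k i A : (k < N)%N -> F k A ->
  (\int[P]_(x in A) (w k x i 0 ^+ 2)%:E = \int[P]_(x in A) (Delta k i i)%:E)%E.
Proof.
move=> kN FA; have [_ _ covD] := mdw kN.
have mA : measurable A := filtration_measurable (ltnW kN) FA.
have wiE : (fun z => (w k z *m (w k z)^T) i i) = (fun z => w k z i 0 ^+ 2).
  by apply/funext => z; rewrite mxE big_ord1 mxE.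
have iw := Lfun2_integrable_sqr (noise_Lfun2 i kN).
have [_ iE _ EA] := condexpP (ltnW kN) iw.
rewrite -EA//; apply: ae_eq_integral => //.
  by apply: measurable_funTS; exact: measurable_int iE.
apply: filterS covD => x /matrixP/(_ i i); rewrite mxE wiE => -> //.
Qed.

(** A product of two L2 functions is in general only integrable. Here [X] is F_k-measurable, so the
    second moment of the product is [Delta k i i] times that of [X]. *)
Lemma L2_noise_scale r k i (X : rv r) : (k < N)%N -> l2F P w k X ->
  L2 (noise_scale k i X).
Proof.
move=> kN X2 j; have [mX jX2] := X2 j.
have GT := filtration_measurable (ltnW kN).
rewrite (_ : (fun x => _) = fun x => w k x i 0 * X x j 0); last first.
  by apply/funext => x; rewrite mxE.
apply: Lfun2_sqr_lty.
  apply: measurable_funM; first exact: measurable_Lfun (noise_Lfun2 i kN).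
  exact: measurable_Lfun jX2.
rewrite (ge0_integral_sqrM GT (noise_Lfun2 i kN) (C := Delta k i i))//; last first.
  by move=> A FA; exact: noise_second_moment.
have iX2 := Lfun2_integrable_sqr jX2.
have fX2 := integrable_fin_num measurableT iX2.
by rewrite -(fineK fX2) -EFinM ltry.
Qed.

Lemma l2F_noise_scale r k i (X : rv r) : (k < N)%N -> l2F P w k X ->
  l2F P w k.+1 (noise_scale k i X).
Proof.
move=> kN X2 j; split; last exact: L2_noise_scale.
rewrite (_ : (fun x => _) = fun x => w k x i 0 * X x j 0); last first.
  by apply/funext => x; rewrite mxE.
apply: measurable_funM; first exact: noise_F_measurable.
by have [mX _] := X2 j; exact: F_measurable_mono mX.
Qed.

Let integrable_noise_scale r k i (Y : rv r) j : (k < N)%N -> L2 Y ->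
  P.-integrable [set: T] (EFin \o (fun x => noise_scale k i Y x j 0)).
Proof.
move=> kN Y2; rewrite (_ : (fun x => _) = fun x => w k x i 0 * Y x j 0); last first.
  by apply/funext => x; rewrite mxE.
by apply/Lfun1_integrable; apply: Lfun2_mul_Lfun1 => //; exact: noise_Lfun2.
Qed.

(** The product of the noise with [Y] is merely integrable, yet its conditional expectation is in
    L2, by a conditional Cauchy-Schwarz bound with constant [Delta k i i]. *)
Lemma l2F_condexp_noise r k i (Y : rv r) : (k < N)%N -> L2 Y ->
  l2F P w k (EM k (noise_scale k i Y)).
Proof.
move=> kN Y2 j; have iwY := integrable_noise_scale i j kN Y2.
rewrite (_ : (fun x => _) = E k (fun x => noise_scale k i Y x j 0)); last first.
  by apply/funext => x; rewrite mxE.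
have [_ iE mE EA] := condexpP (ltnW kN) iwY.
split => //.
apply: (Lfun2_condexpM (filtration_measurable (ltnW kN)) (noise_Lfun2 i kN)
  (C := Delta k i i) _ (Y2 j) iE mE).
  by move=> A FA; exact: noise_second_moment.
by move=> A FA; rewrite EA//; apply: eq_integral => x _; rewrite mxE.
Qed.

Lemma integrable_L2 r (Y : rv r) j : L2 Y ->
  P.-integrable [set: T] (EFin \o (fun x => Y x j 0)).
Proof.
move=> Y2; apply/Lfun1_integrable; apply: Lfun_subset12 (Y2 j).
exact: fin_num_measure.
Qed.

Lemma l2F_condexp r k (Y : rv r) : (k <= N)%N -> L2 Y -> l2F P w k (EM k Y).
Proof.
move=> kN Y2 j; have iY := integrable_L2 j Y2.
rewrite (_ : (fun x => _) = E k (fun x => Y x j 0)); last first.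
  by apply/funext => x; rewrite mxE.
have [_ iE mE EA] := condexpP kN iY.
split => //.
(* Plain conditional expectation is the case of the constant factor 1, whose conditional second
   moment is 1. *)
apply: (Lfun2_condexpM (filtration_measurable kN) (Lfun_cst P 1 2)
  (C := 1) _ (Y2 j) iE mE).
  by move=> A FA; apply: eq_integral => x _; rewrite expr1n.
by move=> A FA; rewrite EA//; apply: eq_integral => x _; rewrite mul1r.
Qed.

(** Only integrability of [Y] and of its products with [X] is assumed, so that [Y] may be a
    noise-scaled vector, which need not be in L2. *)
Let inner_condexp_aux r k (X Y Y' : rv r) A : (k <= N)%N -> F k A ->
  l2F P w k X -> L2 (EM k Y) ->
  (forall j, P.-integrable [set: T] (EFin \o (fun x => Y x j 0))) ->
  (forall j, P.-integrable [set: T] (EFin \o (fun x => X x j 0 * Y x j 0))) ->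
  inner A X (EM k Y) = \sum_j \int[P]_(x in A) (X x j 0 * Y x j 0).
Proof.
move=> kN FA X2 EY2 iY iXY.
have GT := filtration_measurable kN.
have mA : measurable A := GT _ FA.
rewrite innerE//; last exact: l2F_L2.
apply: eq_bigr => j _; have [_ iE mE EA] := condexpP kN (iY j).
have [mX X2j] := X2 j.
have EYE : (fun x => EM k Y x j 0) = E k (fun x => Y x j 0).
  by apply/funext => x; rewrite mxE.
under [LHS]eq_Rintegral do rewrite mxE.
apply: (RintegralM_eq GT iE (iY j) EA mX) => //.
by apply/Lfun1_integrable; apply: Lfun2_mul_Lfun1 => //; rewrite -EYE.
Qed.

Lemma inner_condexp r k (X Y : rv r) A : (k <= N)%N -> F k A ->
  l2F P w k X -> L2 Y -> inner A X (EM k Y) = inner A X Y.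
Proof.
move=> kN FA X2 Y2.
have mA : measurable A := filtration_measurable kN FA.
rewrite inner_condexp_aux//; last 3 first.
- exact/l2F_L2/l2F_condexp.
- by move=> j; exact: integrable_L2.
- by move=> j; apply/Lfun1_integrable; apply: Lfun2_mul_Lfun1 => //; case: (X2 j).
by rewrite innerE//; exact: l2F_L2.
Qed.

(** Multiplication by the scalar noise on F_k-measurable vectors is adjoint to conditioning the
    noise-scaled vector: the noise moves onto [X], where the product is in L2. *)
Lemma inner_condexp_noise r k i (X Y : rv r) A : (k < N)%N -> F k A ->
  l2F P w k X -> L2 Y ->
  inner A X (EM k (noise_scale k i Y)) = inner A (noise_scale k i X) Y.
Proof.
move=> kN FA X2 Y2.
have mA : measurable A := filtration_measurable (ltnW kN) FA.
have wXE j : (fun x => X x j 0 * noise_scale k i Y x j 0) =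
    (fun x => noise_scale k i X x j 0 * Y x j 0).
  by apply/funext => x; rewrite !mxE mulrCA mulrA.
rewrite inner_condexp_aux//; last 4 first.
- exact: ltnW.
- exact/l2F_L2/l2F_condexp_noise.
- by move=> j; exact: integrable_noise_scale.
- move=> j; rewrite wXE; apply/Lfun1_integrable; apply: Lfun2_mul_Lfun1 => //.
  exact: L2_noise_scale.
rewrite innerE//; last exact: L2_noise_scale.
by apply: eq_bigr => j _; rewrite wXE.
Qed.

End filtration.

End random_vectors.


(** * The second-order expansion of the cost *)

(* Reification compares atoms up to conversion, which diverges on integrals. *)
Ltac ring_inner := repeat match goal with
  | |- context [inner ?P ?e ?X ?Y] =>
    let a := fresh in generalize (inner P e X Y); intro a
  end; ring.

Section stacked.
Context {d : measure_display} {T : measurableType d} {R : realType}.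
Variable P : probability T R.
Context {n m1 m2 p : nat}.
Variables (N : nat) (w : nat -> T -> 'cV[R]_p) (Delta : nat -> 'M[R]_p).
Variables (sys : system R n m1 m2 p) (W : weights R n m1 m2).
Hypothesis mdw : martingale_difference P w N Delta.
Hypothesis symW : symmetric_weights N W.

Local Notation m := (m1 + m2)%N.
Local Notation EM := (condexp_mx P w).
Local Notation rv r := (T -> 'cV[R]_r).
Local Notation F k := <<s noise_gen w k >>.
Local Notation L2 := (L2 P).
Local Notation "M *f X" := (mulmxf M X) (at level 40, left associativity).
Local Notation l2F := (l2F P w).

Lemma mulmxfD r c (M : 'M[R]_(r, c)) (X Y : rv c) : M *f (X + Y) = M *f X + M *f Y.
Proof. by apply/funext => x; rewrite /mulmxf !fctE mulmxDr. Qed.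

Lemma mulmxfZ r c (M : 'M[R]_(r, c)) a (X : rv c) : M *f (a *: X) = a *: (M *f X).
Proof. by apply/funext => x; rewrite /mulmxf !fctE -scalemxAr. Qed.

(** Both controls are stacked into one vector of length m1 + m2, so that a single expansion of the
    cost serves both players. *)
Definition drift (k : nat) (Y : rv n) (U : rv m) : rv n :=
  sA sys k *f Y + row_mx (sB1 sys k) (sB2 sys k) *f U.

Definition diffusion (k : nat) (i : 'I_p) (Y : rv n) (U : rv m) : rv n :=
  sC sys k i *f Y + row_mx (sD1 sys k i) (sD2 sys k i) *f U.

(** A predicate restricted to the horizon, rather than the solution of a recursion: sums, multiples
    and later restarts of trajectories are then again trajectories. *)
Definition trajectory (s : nat) (X : nat -> rv n) (U : nat -> rv m) : Prop :=
  forall k, (s <= k < N)%N -> X k.+1 =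
    drift k (X k) (U k) + \sum_(i < p) noise_scale w k i (diffusion k i (X k) (U k)).

Lemma trajectory_l2F s X U : l2F s (X s) ->
  (forall k, (s <= k < N)%N -> l2F k (U k)) -> trajectory s X U ->
  forall k, (s <= k <= N)%N -> l2F k (X k).
Proof.
move=> Xs U2 XU; elim=> [|k ih].
  by rewrite leqn0 => /andP[/eqP s0 _]; rewrite s0 in Xs *.
rewrite leq_eqVlt => /andP[/predU1P[<-//|]]; rewrite ltnS => sk kN.
have Xk : l2F k (X k) by apply: ih; rewrite sk ltnW.
have Uk : l2F k (U k) by apply: U2; rewrite sk.
rewrite XU ?sk//; apply: l2FD.
  by apply: (l2F_mono (leqnSn k)); apply: l2FD; exact: l2F_mulmxf.
apply: l2F_sum => i; apply: (l2F_noise_scale mdw) => //.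
by apply: l2FD; exact: l2F_mulmxf.
Qed.

(* [costate_state] and [costate_control] are the contributions of the costate
   [Y] at time k+1 to the gradients in the state and the control at time k. *)
Definition costate_state (k : nat) (Y : rv n) : rv n :=
  (sA sys k)^T *f EM k Y
  + \sum_(i < p) (sC sys k i)^T *f EM k (noise_scale w k i Y).

Definition costate_control (k : nat) (Y : rv n) : rv m :=
  (row_mx (sB1 sys k) (sB2 sys k))^T *f EM k Y
  + \sum_(i < p) (row_mx (sD1 sys k i) (sD2 sys k i))^T *f EM k (noise_scale w k i Y).

(** Half the derivative of the running cost in the state; the factor 2 reappears in the
    expansion. *)
Definition grad_state (s k : nat) (Y : rv n) (U : rv m) : rv n :=
  wQ W s k *f Y + wQb W s k *f EM s Y
  + ((wS W s k)^T *f U + (wSb W s k)^T *f EM s U) + cst (wq W s k).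

Definition grad_control (s k : nat) (Y : rv n) (U : rv m) : rv m :=
  wS W s k *f Y + wSb W s k *f EM s Y
  + (wR W s k *f U + wRb W s k *f EM s U) + cst (wrho W s k).

Definition grad_final (s : nat) (Y : rv n) : rv n :=
  wG W s *f Y + wGb W s *f EM s Y + cst (wg W s).

Definition costate (s : nat) (X : nat -> rv n) (U : nat -> rv m)
    (Y : nat -> rv n) : Prop :=
  Y N = grad_final s (X N) /\
  forall k, (s <= k < N)%N ->
    Y k = grad_state s k (X k) (U k) + costate_state k (Y k.+1).

(** The stationary condition of each player is a block of this vector, the upper one for the first
    player and the lower one for the second. *)
Definition hamiltonian_grad (s : nat) (X : nat -> rv n) (U : nat -> rv m)
    (Y : nat -> rv n) (k : nat) : rv m :=
  grad_control s k (X k) (U k) + costate_control k (Y k.+1).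

Lemma l2F_costate_state k Y : (k < N)%N -> L2 Y -> l2F k (costate_state k Y).
Proof.
move=> kN Y2; apply: l2FD.
  by apply: l2F_mulmxf; apply: (l2F_condexp mdw) => //; exact: ltnW.
by apply: l2F_sum => i; apply: l2F_mulmxf; exact: (l2F_condexp_noise mdw).
Qed.

Lemma l2F_costate_control k Y : (k < N)%N -> L2 Y -> l2F k (costate_control k Y).
Proof.
move=> kN Y2; apply: l2FD.
  by apply: l2F_mulmxf; apply: (l2F_condexp mdw) => //; exact: ltnW.
by apply: l2F_sum => i; apply: l2F_mulmxf; exact: (l2F_condexp_noise mdw).
Qed.

Lemma l2F_condexp_later r s k (Y : rv r) : (s <= k <= N)%N -> L2 Y -> l2F k (EM s Y).
Proof.
move=> /andP[sk kN] Y2; apply: (l2F_mono sk); apply: (l2F_condexp mdw) => //.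
exact: leq_trans kN.
Qed.

Lemma l2F_grad_control s k Y U : (s <= k <= N)%N -> l2F k Y -> l2F k U ->
  l2F k (grad_control s k Y U).
Proof.
move=> skN Y2 U2; have EY := l2F_condexp_later skN (l2F_L2 Y2).
have EU := l2F_condexp_later skN (l2F_L2 U2).
apply: l2FD; last exact: l2F_cst.
by apply: l2FD; apply: l2FD; exact: l2F_mulmxf.
Qed.

Lemma L2_grad_state s k Y U : (s <= N)%N -> L2 Y -> L2 U -> L2 (grad_state s k Y U).
Proof.
move=> sN Y2 U2.
have EY := l2F_L2 (l2F_condexp mdw sN Y2); have EU := l2F_L2 (l2F_condexp mdw sN U2).
apply: L2D; last exact: L2_cst.
by apply: L2D; apply: L2D; exact: L2_mulmxf.
Qed.

Lemma L2_grad_control s k Y U : (s <= N)%N -> L2 Y -> L2 U -> L2 (grad_control s k Y U).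
Proof.
move=> sN Y2 U2.
have EY := l2F_L2 (l2F_condexp mdw sN Y2); have EU := l2F_L2 (l2F_condexp mdw sN U2).
apply: L2D; last exact: L2_cst.
by apply: L2D; apply: L2D; exact: L2_mulmxf.
Qed.

Lemma L2_grad_final s Y : (s <= N)%N -> L2 Y -> L2 (grad_final s Y).
Proof.
move=> sN Y2; have EY := l2F_L2 (l2F_condexp mdw sN Y2).
apply: L2D; last exact: L2_cst.
by apply: L2D; exact: L2_mulmxf.
Qed.

Lemma L2_costate s X U Y : (s <= N)%N ->
  (forall k, (s <= k <= N)%N -> L2 (X k)) ->
  (forall k, (s <= k < N)%N -> L2 (U k)) -> costate s X U Y ->
  forall k, (s <= k <= N)%N -> L2 (Y k).
Proof.
move=> sN X2 U2 [YN Yk].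
(* Backward induction from [N], run on the distance [j] to the horizon. *)
suff H j : (j <= N - s)%N -> L2 (Y (N - j)%N).
  move=> k /andP[sk kN]; rewrite -(subKn kN); apply: H; exact: leq_sub2l.
elim: j => [_|j ih jN].
  by rewrite subn0 YN; apply: L2_grad_final => //; apply: X2; rewrite sN leqnn.
have kN : (N - j.+1 < N)%N by lia.
have sk : (s <= N - j.+1)%N by lia.
rewrite Yk ?sk//; apply: L2D.
  by apply: L2_grad_state => //; [apply: X2; rewrite sk ltnW|apply: U2; rewrite sk].
apply: l2F_L2; apply: l2F_costate_state => //.
by rewrite subnSK; [apply: ih; lia|lia].
Qed.

Lemma l2F_hamiltonian_grad s X U Y k : (s <= k < N)%N ->
  l2F k (X k) -> l2F k (U k) -> L2 (Y k.+1) -> l2F k (hamiltonian_grad s X U Y k).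
Proof.
move=> /andP[sk kN] X2 U2 Y2; apply: l2FD; last exact: l2F_costate_control.
by apply: l2F_grad_control => //; rewrite sk ltnW.
Qed.

(** * State-costate duality and expansion of the cost over one event *)

Section duality.
Variables (s : nat) (e : set T).
Hypotheses (sN : (s <= N)%N) (Fe : F s e).

Let me : measurable e := filtration_measurable mdw sN Fe.

Let Fek k : (s <= k)%N -> F k e.
Proof. by move=> sk; exact: noise_gen_mono Fe. Qed.

(** Since [xi] and [h] are F_k-measurable, conditional expectations can be inserted on [Y] and the
    noise moved onto it; transposing the system matrices then gives the costate operators. *)
Lemma inner_costate_step k (xi : rv n) (h : rv m) (Y : rv n) : (s <= k < N)%N ->
  l2F k xi -> l2F k h -> L2 Y ->
  inner P e (drift k xi h + \sum_(i < p) noise_scale w k i (diffusion k i xi h)) Y =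
  inner P e xi (costate_state k Y) + inner P e h (costate_control k Y).
Proof.
move=> /andP[sk kN] xi2 h2 Y2.
have EY := l2F_condexp mdw (ltnW kN) Y2.
have EwY i := l2F_condexp_noise mdw i kN Y2.
have dr : l2F k (drift k xi h) by apply: l2FD; exact: l2F_mulmxf.
have di i : l2F k (diffusion k i xi h) by apply: l2FD; exact: l2F_mulmxf.
have wdi i := L2_noise_scale mdw i kN (di i).
have toL2 r (X : rv r) : l2F k X -> L2 X by exact: l2F_L2.
rewrite innerDl//; [|exact: toL2|exact: L2_sum].
rewrite inner_suml// -(inner_condexp mdw (ltnW kN) (Fek sk) dr Y2).
under eq_bigr do rewrite -(inner_condexp_noise mdw _ kN (Fek sk) (di _) Y2).
rewrite /drift /diffusion /costate_state /costate_control.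
have mL2 r c (M : 'M[R]_(c, r)) (X : rv r) : l2F k X -> L2 (M *f X).
  by move=> X2; apply: L2_mulmxf; exact: toL2.
rewrite innerDl//; [|exact: mL2|exact: mL2|exact: toL2].
under eq_bigr do (rewrite innerDl//; [|exact: mL2|exact: mL2|exact: toL2]).
rewrite big_split/= !inner_mulmxf.
under eq_bigr do rewrite inner_mulmxf.
under [X in _ + (_ + X)]eq_bigr do rewrite inner_mulmxf.
rewrite !innerDr//; try exact: toL2; try exact: mL2; try by apply: L2_sum => i;
  exact: mL2.
rewrite !inner_sumr//; try exact: toL2; try by move=> i; exact: mL2.
by rewrite addrACA.
Qed.

Lemma duality (X : nat -> rv n) (U : nat -> rv m) Y (xi : nat -> rv n) (h : nat -> rv m) :
  (forall k, (s <= k <= N)%N -> L2 (X k)) ->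
  (forall k, (s <= k < N)%N -> L2 (U k)) -> costate s X U Y ->
  (forall k, (s <= k < N)%N -> l2F k (h k)) -> xi s = cst 0 -> trajectory s xi h ->
  \sum_(s <= k < N) (inner P e (xi k) (grad_state s k (X k) (U k)) +
                     inner P e (h k) (grad_control s k (X k) (U k)))
  + inner P e (xi N) (grad_final s (X N)) =
  \sum_(s <= k < N) inner P e (h k) (hamiltonian_grad s X U Y k).
Proof.
move=> X2 U2 cY h2 xis xih.
have Y2 := L2_costate sN X2 U2 cY.
have xi2 : forall k, (s <= k <= N)%N -> l2F k (xi k).
  by apply: trajectory_l2F xih => //; rewrite xis; exact: l2F_cst.
have [YN Yk] := cY.
rewrite -YN.
(* The boundary term at [s] vanishes because [xi] starts at 0. *)
have -> : inner P e (xi N) (Y N) =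
    \sum_(s <= k < N) (inner P e (xi k.+1) (Y k.+1) - inner P e (xi k) (Y k)).
  by rewrite telescope_sumr// xis inner0l// subr0.
rewrite -big_split/=; apply: eq_big_nat => k skN.
have /andP[sk kN] := skN.
have skN' : (s <= k <= N)%N by rewrite sk ltnW.
have Yk1 : L2 (Y k.+1) by apply: Y2; rewrite kN andbT leqW.
have X2k := X2 _ skN'; have U2k := U2 _ skN.
have xik := xi2 _ skN'; have hk := h2 _ skN.
have xik' := l2F_L2 xik; have hk' := l2F_L2 hk.
rewrite (xih _ skN) inner_costate_step// (Yk _ skN).
have gc2 := L2_grad_control k sN X2k U2k.
have gs2 := L2_grad_state k sN X2k U2k.
have cs2 := l2F_L2 (l2F_costate_state kN Yk1).
have cc2 := l2F_L2 (l2F_costate_control kN Yk1).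
rewrite (innerDr me xik' gs2 cs2) (innerDr me hk' gc2 cc2).
by ring_inner.
Qed.


Section bilinear_expansion.
Variables (r c : nat).

Let EL2 q (X : rv q) : L2 X -> L2 (EM s X).
Proof. by move=> X2; exact: l2F_L2 (l2F_condexp mdw sN X2). Qed.

Lemma inner_condexpl (X Y : rv r) : L2 X -> l2F s Y ->
  inner P e (EM s X) Y = inner P e X Y.
Proof. by move=> X2 Y2; rewrite innerC (inner_condexp mdw)// innerC. Qed.

(** Both cross terms have the increment on the left: for symmetric [M] and equal arguments they
    coincide, and they match the terms of the gradients. *)
Lemma inner_mulmxfD (M : 'M[R]_(r, c)) (U h : rv r) (X xi : rv c) :
  L2 U -> L2 h -> L2 X -> L2 xi ->
  inner P e (U + h) (M *f (X + xi)) =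
  inner P e U (M *f X) + inner P e xi (M^T *f U) + inner P e h (M *f X) +
  inner P e h (M *f xi).
Proof.
move=> U2 h2 X2 xi2.
have MX := L2_mulmxf M X2; have Mxi := L2_mulmxf M xi2.
rewrite mulmxfD (innerDr me (L2D U2 h2) MX Mxi) !innerDl//.
rewrite (innerC _ _ xi) inner_mulmxf trmxK; ring_inner.
Qed.

Let F2 q (Z : rv q) : L2 Z -> l2F s (EM s Z).
Proof. exact: (l2F_condexp mdw). Qed.

Lemma inner_condexp_mulmxfl (M : 'M[R]_(r, c)) (U : rv r) (X : rv c) :
  L2 U -> L2 X ->
  inner P e (EM s U) (M *f EM s X) = inner P e U (M *f EM s X).
Proof. by move=> U2 X2; apply: inner_condexpl => //; apply: l2F_mulmxf; exact: F2. Qed.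

Lemma inner_condexp_mulmxfr (M : 'M[R]_(r, c)) (U : rv r) (X : rv c) :
  L2 U -> L2 X ->
  inner P e (EM s U) (M *f EM s X) = inner P e (M^T *f EM s U) X.
Proof.
move=> U2 X2; rewrite -{1}[M]trmxK -inner_mulmxf.
by rewrite (inner_condexp mdw sN Fe _ X2)//; apply: l2F_mulmxf; exact: F2.
Qed.

(** The chosen versions are not additive pointwise. Since the other factor is F_s-measurable, the
    conditional expectation of a sum can be removed inside the integral, the sum split, and the
    expectation put back. In the cross terms the increment is left unconditioned, as in the
    gradients. *)
Lemma inner_condexp_mulmxfD (M : 'M[R]_(r, c)) (U h : rv r) (X xi : rv c) :
  L2 U -> L2 h -> L2 X -> L2 xi ->
  inner P e (EM s (U + h)) (M *f EM s (X + xi)) =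
  inner P e (EM s U) (M *f EM s X) + inner P e xi (M^T *f EM s U)
  + inner P e h (M *f EM s X) + inner P e (EM s h) (M *f EM s xi).
Proof.
move=> U2 h2 X2 xi2.
have EMl := inner_condexp_mulmxfl M; have EMr := inner_condexp_mulmxfr M.
have bDl (V V' : rv r) (Z : rv c) : L2 V -> L2 V' -> L2 Z ->
    inner P e (EM s (V + V')) (M *f EM s Z) =
    inner P e (EM s V) (M *f EM s Z) + inner P e (EM s V') (M *f EM s Z).
  move=> V2 V'2 Z2; have VV' := L2D V2 V'2.
  by rewrite !EMl// innerDl//; apply: L2_mulmxf; exact: EL2.
have bDr (V : rv r) (Z Z' : rv c) : L2 V -> L2 Z -> L2 Z' ->
    inner P e (EM s V) (M *f EM s (Z + Z')) =
    inner P e (EM s V) (M *f EM s Z) + inner P e (EM s V) (M *f EM s Z').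
  move=> V2 Z2 Z'2; have ZZ' := L2D Z2 Z'2.
  by rewrite !EMr// innerDr//; apply: L2_mulmxf; exact: EL2.
have Uh := L2D U2 h2.
rewrite (bDr _ _ _ Uh X2 xi2) (bDl _ _ _ U2 h2 X2) (bDl _ _ _ U2 h2 xi2).
by rewrite (EMl _ _ h2 X2) (EMr _ _ U2 xi2) (innerC _ _ _ xi) addrACA !addrA.
Qed.

Lemma inner_mulmxfZ (M : 'M[R]_(r, c)) a (U : rv r) (X : rv c) : L2 U -> L2 X ->
  inner P e (a *: U) (M *f (a *: X)) = a ^+ 2 * inner P e U (M *f X).
Proof.
move=> U2 X2; have MX := L2_mulmxf M X2.
by rewrite mulmxfZ (innerZr me a (L2Z a U2) MX) innerZl// mulrA.
Qed.

Lemma inner_condexp_mulmxfZ (M : 'M[R]_(r, c)) a (U : rv r) (X : rv c) :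
  L2 U -> L2 X ->
  inner P e (EM s (a *: U)) (M *f EM s (a *: X)) =
  a ^+ 2 * inner P e (EM s U) (M *f EM s X).
Proof.
move=> U2 X2.
have EMl := inner_condexp_mulmxfl M; have EMr := inner_condexp_mulmxfr M.
have aU := L2Z a U2; have aX := L2Z a X2.
have ME (Z : rv c) : L2 Z -> L2 (M *f EM s Z) by move=> Z2; apply: L2_mulmxf; exact: EL2.
have MTE : L2 (M^T *f EM s U) by apply: L2_mulmxf; exact: EL2.
rewrite (EMl _ _ aU aX) (innerZl me a U2 (ME _ aX)) -(EMl _ _ U2 aX) (EMr _ _ U2 aX).
by rewrite (innerZr me a MTE X2) -(EMr _ _ U2 X2) mulrA.
Qed.

End bilinear_expansion.

Let inner_sum5 r (Z a b c f g : rv r) : L2 Z -> L2 a -> L2 b -> L2 c -> L2 f -> L2 g ->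
  inner P e Z (a + b + (c + f) + g) =
  inner P e Z a + inner P e Z b + inner P e Z c + inner P e Z f + inner P e Z g.
Proof.
move=> Z2 a2 b2 c2 f2 g2; have ab := L2D a2 b2; have cf := L2D c2 f2.
by rewrite (innerDr me Z2 (L2D ab cf) g2) (innerDr me Z2 ab cf) !innerDr// !addrA.
Qed.

Definition running_quad (k : nat) (X : rv n) (U : rv m) : R :=
  inner P e X (wQ W s k *f X) + 2 * inner P e U (wS W s k *f X)
  + inner P e U (wR W s k *f U)
  + inner P e (EM s X) (wQb W s k *f EM s X)
  + 2 * inner P e (EM s U) (wSb W s k *f EM s X)
  + inner P e (EM s U) (wRb W s k *f EM s U).

Definition final_quad (X : rv n) : R :=
  inner P e X (wG W s *f X) + inner P e (EM s X) (wGb W s *f EM s X).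

Definition quad_cost (X : nat -> rv n) (U : nat -> rv m) : R :=
  \sum_(s <= k < N) running_quad k (X k) (U k) + final_quad (X N).

Definition linear_cost (X : nat -> rv n) (U : nat -> rv m) : R :=
  \sum_(s <= k < N) (inner P e (cst (wq W s k)) (X k) +
                     inner P e (cst (wrho W s k)) (U k))
  + inner P e (cst (wg W s)) (EM s (X N)).

Definition total_cost X U : R := quad_cost X U + 2 * linear_cost X U.

(** Symmetry merges the cross terms into twice the gradient terms. The gradients contain the
    constants q and rho, which belong to the linear cost; they are subtracted here and cancel in
    [total_costD]. *)
Lemma running_quadD k (X xi : rv n) (U h : rv m) : (k < N)%N -> (s <= k)%N ->
  L2 X -> L2 xi -> L2 U -> L2 h ->
  running_quad k (X + xi) (U + h) = running_quad k X U + running_quad k xi h +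
    2 * (inner P e xi (grad_state s k X U) + inner P e h (grad_control s k X U)
         - inner P e xi (cst (wq W s k)) - inner P e h (cst (wrho W s k))).
Proof.
move=> kN sk X2 xi2 U2 h2.
have [symQ _] := symW; have [Q1 Qb1 R1 Rb1] : [/\ _, _, _ & _] :=
  symQ s k (introT andP (conj sk kN)).
have EX := l2F_L2 (l2F_condexp mdw sN X2); have EU := l2F_L2 (l2F_condexp mdw sN U2).
rewrite /running_quad !inner_mulmxfD// !inner_condexp_mulmxfD// Q1 Qb1 R1 Rb1.
rewrite /grad_state /grad_control.
rewrite (inner_sum5 xi2 (L2_mulmxf _ X2) (L2_mulmxf _ EX) (L2_mulmxf _ U2)
  (L2_mulmxf _ EU) (L2_cst _ _)).
rewrite (inner_sum5 h2 (L2_mulmxf _ X2) (L2_mulmxf _ EX) (L2_mulmxf _ U2)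
  (L2_mulmxf _ EU) (L2_cst _ _)).
ring_inner.
Qed.

Lemma final_quadD (X xi : rv n) : (s < N)%N -> L2 X -> L2 xi ->
  final_quad (X + xi) = final_quad X + final_quad xi +
    2 * (inner P e xi (grad_final s X) - inner P e xi (cst (wg W s))).
Proof.
move=> ltsN X2 xi2; have [_ /(_ s ltsN)[G1 Gb1]] := symW.
have EX := l2F_L2 (l2F_condexp mdw sN X2).
rewrite /final_quad !inner_mulmxfD// !inner_condexp_mulmxfD// G1 Gb1 /grad_final.
have GX := L2_mulmxf (wG W s) X2; have GEX := L2_mulmxf (wGb W s) EX.
rewrite (innerDr me xi2 (L2D GX GEX) (L2_cst _ _)) (innerDr me xi2 GX GEX).
ring_inner.
Qed.

Lemma linear_costD X xi U h :
  (forall k, (s <= k <= N)%N -> L2 (X k)) -> (forall k, (s <= k <= N)%N -> L2 (xi k)) ->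
  (forall k, (s <= k < N)%N -> L2 (U k)) -> (forall k, (s <= k < N)%N -> L2 (h k)) ->
  linear_cost (X + xi) (U + h) = linear_cost X U +
    (\sum_(s <= k < N) (inner P e (xi k) (cst (wq W s k)) +
                        inner P e (h k) (cst (wrho W s k)))
     + inner P e (xi N) (cst (wg W s))).
Proof.
move=> X2 xi2 U2 h2; rewrite /linear_cost.
have sNN : (s <= N <= N)%N by rewrite sN leqnn.
have gE Z : L2 Z -> inner P e (cst (wg W s)) (EM s Z) = inner P e (cst (wg W s)) Z.
  by move=> Z2; rewrite (inner_condexp mdw sN Fe (l2F_cst _ _ _ _) Z2).
have XN := X2 _ sNN; have xiN := xi2 _ sNN.
rewrite (gE _ (L2D XN xiN)) (gE _ XN) (innerDr me (L2_cst _ _) XN xiN).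
rewrite (innerC P e (xi N)) [RHS]addrACA; congr (_ + _); rewrite -big_split/=.
apply: eq_big_nat => k skN; have [sk kN] := andP skN.
have skN' : (s <= k <= N)%N by rewrite sk ltnW.
rewrite (innerDr me (L2_cst _ _) (X2 _ skN') (xi2 _ skN')).
rewrite (innerDr me (L2_cst _ _) (U2 _ skN) (h2 _ skN)).
by rewrite (innerC P e (xi k)) (innerC P e (h k)) addrACA.
Qed.

Lemma quad_costD X U xi h : (s < N)%N ->
  (forall k, (s <= k <= N)%N -> L2 (X k)) -> (forall k, (s <= k <= N)%N -> L2 (xi k)) ->
  (forall k, (s <= k < N)%N -> L2 (U k)) -> (forall k, (s <= k < N)%N -> L2 (h k)) ->
  quad_cost (X + xi) (U + h) = quad_cost X U + quad_cost xi h +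
    2 * (\sum_(s <= k < N) (inner P e (xi k) (grad_state s k (X k) (U k)) +
                            inner P e (h k) (grad_control s k (X k) (U k)))
         + inner P e (xi N) (grad_final s (X N))
         - (\sum_(s <= k < N) (inner P e (xi k) (cst (wq W s k)) +
                               inner P e (h k) (cst (wrho W s k)))
            + inner P e (xi N) (cst (wg W s)))).
Proof.
move=> ltsN X2 xi2 U2 h2.
have sNN : (s <= N <= N)%N by rewrite sN leqnn.
have S : \sum_(s <= k < N) running_quad k ((X + xi) k) ((U + h) k) =
  \sum_(s <= k < N) running_quad k (X k) (U k) +
  \sum_(s <= k < N) running_quad k (xi k) (h k) +
  2 * (\sum_(s <= k < N) (inner P e (xi k) (grad_state s k (X k) (U k)) +
                     inner P e (h k) (grad_control s k (X k) (U k))) -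
      \sum_(s <= k < N) (inner P e (xi k) (cst (wq W s k)) +
                        inner P e (h k) (cst (wrho W s k)))).
  rewrite -sumrB mulr_sumr -!big_split/=; apply: eq_big_nat => k skN.
  have [sk kN] := andP skN.
  have skN' : (s <= k <= N)%N by rewrite sk ltnW.
  apply: (etrans (running_quadD kN sk (X2 _ skN') (xi2 _ skN') (U2 _ skN) (h2 _ skN))).
  by congr (_ + 2 * _); rewrite opprD addrA.
apply: (etrans (congr2 +%R S (final_quadD ltsN (X2 _ sNN) (xi2 _ sNN)))).
have alg (a b a' b' f g x y : R) : a + b + 2 * (f - g) + (a' + b' + 2 * (x - y)) =
  a + a' + (b + b') + 2 * (f + x - (g + y)) by ring.
exact: alg.
Qed.

(** The q, rho and g corrections of the quadratic and linear expansions cancel, leaving twice the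
    pairing with the gradients, which [duality] rewrites in terms of [h] alone. *)
Lemma total_costD X U Y xi h : (s < N)%N ->
  (forall k, (s <= k <= N)%N -> L2 (X k)) ->
  (forall k, (s <= k < N)%N -> L2 (U k)) -> costate s X U Y ->
  (forall k, (s <= k < N)%N -> l2F k (h k)) -> xi s = cst 0 -> trajectory s xi h ->
  total_cost (X + xi) (U + h) = total_cost X U + quad_cost xi h +
    2 * \sum_(s <= k < N) inner P e (h k) (hamiltonian_grad s X U Y k).
Proof.
move=> ltsN X2 U2 cY h2 xis xih.
have xi2 k : (s <= k <= N)%N -> L2 (xi k).
  move=> skN; apply: (@l2F_L2 _ _ _ _ _ w _ k); apply: trajectory_l2F xih _ skN => //.
  by rewrite xis; exact: l2F_cst.
have h2' k : (s <= k < N)%N -> L2 (h k) by move=> /h2/l2F_L2.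
rewrite -(duality X2 U2 cY h2 xis xih).
apply: (etrans (congr2 (fun a b => a + 2 * b) (quad_costD ltsN X2 xi2 U2 h2')
  (linear_costD X2 xi2 U2 h2'))).
have alg (a b f g x : R) : a + b + 2 * (f - g) + 2 * (x + g) =
  a + 2 * x + b + 2 * f by ring.
exact: alg.
Qed.

Lemma quad_costZ a X U :
  (forall k, (s <= k <= N)%N -> L2 (X k)) ->
  (forall k, (s <= k < N)%N -> L2 (U k)) ->
  quad_cost (a *: X) (a *: U) = a ^+ 2 * quad_cost X U.
Proof.
move=> X2 U2; rewrite /quad_cost mulrDr mulr_sumr; congr (_ + _).
  apply: eq_big_nat => k skN; have [sk kN] := andP skN.
  have Xk : L2 (X k) by apply: X2; rewrite sk ltnW.
  have Uk := U2 _ skN.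
  rewrite /running_quad !inner_mulmxfZ// !inner_condexp_mulmxfZ//.
  ring_inner.
have XN : L2 (X N) by apply: X2; rewrite sN leqnn.
by rewrite /final_quad inner_mulmxfZ// inner_condexp_mulmxfZ// mulrDr.
Qed.

End duality.

End stacked.


(** * Linearity and uniqueness of trajectories, and the responses of the two players *)

Section trajectories.
Context {d : measure_display} {T : measurableType d} {R : realType}.
Context {n m1 m2 p : nat}.
Variables (N : nat) (w : nat -> T -> 'cV[R]_p) (sys : system R n m1 m2 p).

Local Notation m := (m1 + m2)%N.
Local Notation rv r := (T -> 'cV[R]_r).
Local Notation trajectory := (trajectory N w sys).

Lemma noise_scaleD r k i (X Y : rv r) :
  noise_scale w k i (X + Y) = noise_scale w k i X + noise_scale w k i Y.
Proof. by apply/funext => x; rewrite /noise_scale !fctE scalerDr. Qed.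

Lemma noise_scaleZ r k i a (X : rv r) :
  noise_scale w k i (a *: X) = a *: noise_scale w k i X.
Proof. by apply/funext => x; rewrite /noise_scale !fctE !scalerA mulrC. Qed.

Lemma driftD k X Y U V : drift sys k (X + Y) (U + V) =
  drift sys k X U + drift sys k Y V :> rv n.
Proof. by rewrite /drift !mulmxfD addrACA. Qed.

Lemma driftZ k a X U : drift sys k (a *: X) (a *: U) = a *: drift sys k X U :> rv n.
Proof. by rewrite /drift !mulmxfZ scalerDr. Qed.

Lemma diffusionD k i X Y U V :
  diffusion sys k i (X + Y) (U + V) =
    diffusion sys k i X U + diffusion sys k i Y V :> rv n.
Proof. by rewrite /diffusion !mulmxfD addrACA. Qed.

Lemma diffusionZ k i a X U :
  diffusion sys k i (a *: X) (a *: U) = a *: diffusion sys k i X U :> rv n.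
Proof. by rewrite /diffusion !mulmxfZ scalerDr. Qed.

Lemma trajectoryD s (X Y : nat -> rv n) (U V : nat -> rv m) :
  trajectory s X U -> trajectory s Y V -> trajectory s (X + Y) (U + V).
Proof.
move=> XU YV k skN; rewrite [LHS](_ : _ = X k.+1 + Y k.+1)// (XU _ skN) (YV _ skN).
rewrite [(X + Y) k](_ : _ = X k + Y k)// [(U + V) k](_ : _ = U k + V k)//.
rewrite driftD addrACA -big_split/=; congr (_ + _).
by apply: eq_bigr => i _; rewrite diffusionD noise_scaleD.
Qed.

Lemma trajectoryZ s a (X : nat -> rv n) (U : nat -> rv m) :
  trajectory s X U -> trajectory s (a *: X) (a *: U).
Proof.
move=> XU k skN; rewrite [LHS](_ : _ = a *: X k.+1)// (XU _ skN).
rewrite [(a *: X) k](_ : _ = a *: X k)// [(a *: U) k](_ : _ = a *: U k)//.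
rewrite driftZ scalerDr scaler_sumr; congr (_ + _).
by apply: eq_bigr => i _; rewrite diffusionZ noise_scaleZ.
Qed.

(** Identifies the state under perturbed controls with the sum of the reference state and the
    response, on the horizon only, since trajectories are arbitrary elsewhere. *)
Lemma trajectory_unique s (X Y : nat -> rv n) (U V : nat -> rv m) :
  X s = Y s -> (forall k, (s <= k < N)%N -> U k = V k) ->
  trajectory s X U -> trajectory s Y V ->
  forall k, (s <= k <= N)%N -> X k = Y k.
Proof.
move=> XYs UV XU YV; elim=> [|k ih].
  by rewrite leqn0 => /andP[/eqP s0 _]; rewrite s0 in XYs.
rewrite leq_eqVlt => /andP[/predU1P[<-//|]]; rewrite ltnS => sk kN.
have skN : (s <= k < N)%N by rewrite sk.
by rewrite (XU _ skN) (YV _ skN) (UV _ skN) ih// sk ltnW.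
Qed.

Lemma sub_trajectory s k X U : (s <= k)%N -> trajectory s X U -> trajectory k X U.
Proof. by move=> sk XU l /andP[kl lN]; apply: XU; rewrite (leq_trans sk). Qed.

Definition stack (u : nat -> rv m1) (v : nat -> rv m2) : nat -> rv m :=
  fun k x => col_mx (u k x) (v k x).

Lemma stackD u u' v v' : stack u v + stack u' v' = stack (u + u') (v + v').
Proof. by apply/funext => k; apply/funext => x; rewrite /stack !fctE add_col_mx. Qed.

Lemma stackZ a u v : a *: stack u v = stack (a *: u) (a *: v).
Proof. by apply/funext => k; apply/funext => x; rewrite /stack !fctE scale_col_mx. Qed.

Lemma drift_stackE k (X : rv n) u v x : drift sys k X (stack u v k) x =
  sA sys k *m X x + sB1 sys k *m u k x + sB2 sys k *m v k x.
Proof. by rewrite /drift /mulmxf !fctE mul_row_col addrA. Qed.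

Lemma diffusion_stackE k i (X : rv n) u v x : diffusion sys k i X (stack u v k) x =
  sC sys k i *m X x + sD1 sys k i *m u k x + sD2 sys k i *m v k x.
Proof. by rewrite /diffusion /mulmxf !fctE mul_row_col addrA. Qed.

Lemma trajectory_state s y u v : trajectory s (state w sys s y u v) (stack u v).
Proof.
move=> k /andP[sk _]; rewrite /state run_step//; set X := run _ _ _ _.
apply/funext => x; rewrite !fctE drift_stackE fct_sumE; congr (_ + _).
by apply: eq_bigr => i _; rewrite /noise_scale diffusion_stackE.
Qed.

Lemma state_init s y u v : state w sys s y u v s = y.
Proof. exact: run_init. Qed.

Lemma trajectory_alpha s u : trajectory s (alpha w sys s u) (stack u (cst (cst 0))).
Proof.
move=> k /andP[sk _]; rewrite /alpha run_step//; set X := run _ _ _ _.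
apply/funext => x; rewrite !fctE drift_stackE fct_sumE mulmx0 addr0; congr (_ + _).
by apply: eq_bigr => i _; rewrite /noise_scale diffusion_stackE mulmx0 addr0.
Qed.

Lemma alpha_init s u : alpha w sys s u s = cst 0.
Proof. exact: run_init. Qed.

(** The response to an impulse: control [vs] at time [s] and none afterwards. The step at [s] is
    treated apart because the recursion inside [beta] starts only at s + 1. *)
Lemma trajectory_beta s vs : trajectory s (beta w sys s vs)
  (stack (cst (cst 0)) (replace_at s vs (cst (cst 0)))).
Proof.
move=> k /andP[]; rewrite leq_eqVlt => /predU1P[<-|sk] _.
  apply/funext => x; rewrite !fctE drift_stackE fct_sumE /beta ltnn leqnn run_init.
  rewrite /replace_at eqxx !mulmx0 !add0r; congr (_ + _).
  by apply: eq_bigr => i _; rewrite /noise_scale diffusion_stackE eqxx !mulmx0 !add0r.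
have [ks ks1] : (k <= s)%N = false /\ (k.+1 <= s)%N = false by split; lia.
rewrite /beta ks ks1 run_step//; set X := run _ _ _ _.
apply/funext => x; rewrite !fctE drift_stackE fct_sumE /replace_at gtn_eqF//
  !mulmx0 !addr0.
congr (_ + _).
by apply: eq_bigr => i _; rewrite /noise_scale diffusion_stackE /replace_at gtn_eqF//
  !mulmx0 !addr0.
Qed.

Lemma beta_init s vs : beta w sys s vs s = cst 0.
Proof. by rewrite /beta leqnn. Qed.

End trajectories.


(** * From conditional costs to integrals over events *)

Section representation.
Context {d : measure_display} {T : measurableType d} {R : realType}.
Variable P : probability T R.
Context {n m1 m2 p : nat}.
Variables (N : nat) (w : nat -> T -> 'cV[R]_p) (Delta : nat -> 'M[R]_p).
Hypothesis mdw : martingale_difference P w N Delta.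

Local Notation E := (condexp P w).
Local Notation EM := (condexp_mx P w).
Local Notation rv r := (T -> 'cV[R]_r).
Local Notation F k := <<s noise_gen w k >>.
Local Notation L2 := (L2 P).
Local Notation "M *f X" := (mulmxf M X) (at level 40, left associativity).

(* The values [v e], for the events [e] of F_s, determine E[Z | F_s] a.s. *)
Definition represents (s : nat) (Z : T -> R) (v : set T -> R) : Prop :=
  P.-integrable [set: T] (EFin \o Z) /\
  forall e, F s e -> \int[P]_(x in e) Z x = v e.

Section closure.
Variable s : nat.
Hypothesis sN : (s <= N)%N.
Implicit Types (Z : T -> R) (v : set T -> R).

Let mF e : F s e -> measurable e.
Proof. exact: (filtration_measurable mdw). Qed.

Let integrableF Z e : F s e -> P.-integrable [set: T] (EFin \o Z) ->
  P.-integrable e (EFin \o Z).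
Proof. by move=> /mF me iZ; exact: integrableS iZ. Qed.

Lemma represents_eq Z v v' : represents s Z v -> (forall e, F s e -> v e = v' e) ->
  represents s Z v'.
Proof. by move=> [iZ Zv] vv'; split=> // e Fe; rewrite Zv// vv'. Qed.

Lemma representsD Z Z' v v' : represents s Z v -> represents s Z' v' ->
  represents s (fun x => Z x + Z' x) (fun e => v e + v' e).
Proof.
move=> [iZ Zv] [iZ' Zv']; split; first exact: (integrableD measurableT iZ iZ').
move=> e Fe; rewrite RintegralD ?Zv ?Zv'//;
  [exact: mF|exact: integrableF|exact: integrableF].
Qed.

Lemma representsZ a Z v : represents s Z v ->
  represents s (fun x => a * Z x) (fun e => a * v e).
Proof.
move=> [iZ Zv]; split; first exact: (integrableZl measurableT a iZ).
move=> e Fe; rewrite RintegralZl ?Zv//; [exact: mF|exact: integrableF].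
Qed.

Lemma represents0 : represents s (fun=> 0) (fun=> 0).
Proof.
split; first exact: integrable0.
by move=> e Fe; rewrite Rintegral_cst ?mul0r//; exact: mF.
Qed.

Lemma represents_sum (k l : nat) (Z : nat -> T -> R) (v : nat -> set T -> R) :
  (forall i, (k <= i < l)%N -> represents s (Z i) (v i)) ->
  represents s (fun x => \sum_(k <= i < l) Z i x) (fun e => \sum_(k <= i < l) v i e).
Proof.
move=> Zv; under eq_fun do rewrite big_nat_cond.
under [X in represents _ _ X]eq_fun do rewrite big_nat_cond.
elim: (index_iota k l) => [|i r ih].
  under eq_fun do rewrite big_nil; under [X in represents _ _ X]eq_fun do rewrite big_nil.
  exact: represents0.
under eq_fun do rewrite big_cons; under [X in represents _ _ X]eq_fun do rewrite big_cons.
case kil : ((k <= i < l)%N && true) => //.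
by move: kil; rewrite andbT => /Zv ?; exact: representsD.
Qed.

Lemma represents_condexp Z v : represents s Z v -> represents s (E s Z) v.
Proof.
move=> [iZ Zv]; have [_ iE _ EA] := condexpP mdw sN iZ.
by split=> // e Fe; rewrite -Zv// /Rintegral EA.
Qed.

Lemma represents_bil r c (M : 'M[R]_(r, c)) (X : rv r) (Y : rv c) : L2 X -> L2 Y ->
  represents s (fun x => bil (X x) M (Y x)) (fun e => inner P e X (M *f Y)).
Proof.
move=> X2 Y2; under eq_fun do rewrite bilE.
by split=> //; apply: (integrable_dot X2); exact: (L2_mulmxf M).
Qed.

Lemma represents_dot r (c : 'cV[R]_r) (X : rv r) : L2 X ->
  represents s (fun x => dot c (X x)) (fun e => inner P e (cst c) X).
Proof. by move=> X2; split=> //; exact: (integrable_dot (L2_cst P c) X2). Qed.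

Lemma F_measurable_condexp k Z : F_measurable w k (E k Z).
Proof. by rewrite /condexp; case: xgetP => [Y _ []|_] //; exact: measurable_cst. Qed.

Lemma F_measurable_bil k r c (M : 'M[R]_(r, c)) (X : rv r) (Y : rv c) :
  (forall i, F_measurable w k (fun x => X x i 0)) ->
  (forall i, F_measurable w k (fun x => Y x i 0)) ->
  F_measurable w k (fun x => bil (X x) M (Y x)).
Proof.
move=> mX mY; rewrite /F_measurable; under eq_fun do rewrite bilE dotE.
apply: measurable_sum => i; apply: measurable_funM; first exact: mX.
under eq_fun do rewrite mxE; apply: measurable_sum => j.
by apply: measurable_funM => //; exact: mY.
Qed.

Lemma F_measurable_condexp_mx k r (X : rv r) i : F_measurable w k (fun x => EM k X x i 0).
Proof.
rewrite (_ : (fun x => _) = E k (fun x => X x i 0)); first exact: F_measurable_condexp.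
by apply/funext => x; rewrite mxE.
Qed.

(** From events to almost sure order, the test event is the set where the inequality fails; it
    belongs to F_s because both variables are F_s-measurable. *)
Lemma ae_le_represents Z Z' v v' :
  F_measurable w s Z -> F_measurable w s Z' -> represents s Z v -> represents s Z' v' ->
  {ae P, forall x, Z x <= Z' x} <-> (forall e, F s e -> v e <= v' e).
Proof.
move=> mZ mZ' [iZ Zv] [iZ' Zv']; split.
- move=> ZZ' e Fe; rewrite -Zv// -Zv'// -subr_ge0 -RintegralB//;
    [|exact: mF|exact: integrableF|exact: integrableF].
  have iB : P.-integrable e (EFin \o (fun x => Z' x - Z x)).
    exact: (integrableB (mF Fe) (integrableF Fe iZ') (integrableF Fe iZ)).
  (* The difference is nonnegative only almost surely; its absolute value has the same integral and
     is nonnegative everywhere. *)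
  rewrite (_ : Rintegral _ _ _ = \int[P]_(x in e) `|Z' x - Z x|).
    by apply: Rintegral_ge0.
  congr fine; apply: ae_eq_integral; first exact: mF.
  - exact: measurable_int iB.
  - exact: (measurable_int _ (integrable_norm iB)).
  - by apply: filterS ZZ' => x ZZx _ /=; rewrite ger0_norm ?subr_ge0.
- move=> vv'.
  pose e := [set x | Z' x < Z x].
  have Fe : F s e.
    rewrite (_ : e = ~` ([set: T] `&` [set x | Z x <= Z' x])); last first.
      by rewrite setTI; apply/seteqP; split=> x; rewrite /e/= ltNge => /negP.
    apply: (@measurableC _ (g_sigma_algebraType (noise_gen w s))).
    exact: (@measurable_fun_le _ (g_sigma_algebraType (noise_gen w s)) R setT Z Z').
  have me := mF Fe.
  have iB : P.-integrable e (EFin \o (fun x => Z x - Z' x)).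
    exact: (integrableB me (integrableF Fe iZ) (integrableF Fe iZ')).
  have fB := integrable_fin_num me iB.
  (* On [e] the difference is positive while its integral is at most 0, so it vanishes almost
     everywhere on [e], contradicting strictness. *)
  have B0 : (\int[P]_(x in e) `|(Z x - Z' x)%:E|)%E = 0%E.
    rewrite (eq_integral (EFin \o (fun x => Z x - Z' x))); last first.
      by move=> x; rewrite inE /e/= => xe; rewrite gtr0_norm// subr_gt0.
    apply/eqP; rewrite eq_le; apply/andP; split; last first.
      apply: integral_ge0 => x; rewrite /e/= => xe.
      by rewrite lee_fin subr_ge0 ltW.
    rewrite -(fineK fB) lee_fin -[fine _]/(Rintegral _ _ _) RintegralB//;
      [|exact: integrableF|exact: integrableF].
    by rewrite Zv// Zv'// subr_le0 vv'.
  have /(ae_eq_integral_abs _ me (measurable_int _ iB)) := B0.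
  apply: filterS => x ZZ; rewrite leNgt; apply/negP => xe.
  by have := ZZ xe; rewrite /= => -[/eqP]; rewrite subr_eq0 gt_eqF.
Qed.

End closure.
End representation.


(** * Integral representation of the cost functionals *)

Section costs.
Context {d : measure_display} {T : measurableType d} {R : realType}.
Variable P : probability T R.
Context {n m1 m2 p : nat}.
Variables (N : nat) (w : nat -> T -> 'cV[R]_p) (Delta : nat -> 'M[R]_p).
Variables (sys : system R n m1 m2 p) (W : weights R n m1 m2).
Hypothesis mdw : martingale_difference P w N Delta.

Local Notation m := (m1 + m2)%N.
Local Notation EM := (condexp_mx P w).
Local Notation rv r := (T -> 'cV[R]_r).
Local Notation F k := <<s noise_gen w k >>.
Local Notation L2 := (L2 P).
Local Notation l2F := (l2F P w).
Local Notation "M *f X" := (mulmxf M X) (at level 40, left associativity).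
Local Notation rep := (represents P w).

Lemma dot_col_mx (a : 'cV[R]_m1) (b : 'cV[R]_m2) (c : 'cV[R]_m) :
  dot (col_mx a b) c = dot a (usubmx c) + dot b (dsubmx c).
Proof. by rewrite -{1}[c]vsubmxK /dot tr_col_mx mul_row_col mxE. Qed.

Lemma dot0l r (a : 'cV[R]_r) : dot 0 a = 0.
Proof. by rewrite /dot trmx0 mul0mx mxE. Qed.

Lemma stack_L2 (u : nat -> rv m1) (v : nat -> rv m2) k :
  L2 (u k) -> L2 (v k) -> L2 (stack u v k).
Proof.
move=> u2 v2 i; rewrite /stack; under eq_fun do rewrite mxE.
by case: splitP => j _; [exact: u2|exact: v2].
Qed.

Lemma stack_l2F (u : nat -> rv m1) (v : nat -> rv m2) l k :
  l2F l (u k) -> l2F l (v k) -> l2F l (stack u v k).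
Proof.
move=> u2 v2 i; rewrite /stack.
have -> : (fun x => col_mx (u k x) (v k x) i 0) =
    match fintype.split i with inl j => fun x => u k x j 0 | inr j =>
      fun x => v k x j 0 end.
  by apply/funext => x; rewrite mxE; case: splitP.
by case: (fintype.split i) => j; [exact: u2|exact: v2].
Qed.

Lemma condexp_stack s (u : nat -> rv m1) (v : nat -> rv m2) k :
  EM s (stack u v k) = fun x => col_mx (EM s (u k) x) (EM s (v k) x).
Proof.
apply/funext => x; apply/colP => i; rewrite !mxE /stack.
rewrite (_ : (fun z => col_mx _ _ i 0) = fun z => match fintype.split i with
  inl j => u k z j 0 | inr j => v k z j 0 end); last by apply/funext => z; rewrite mxE.
by case: splitP => j _; rewrite mxE.
Qed.

Lemma sum_regroup k l (a b c : nat -> R) (x y z : R) :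
  \sum_(k <= i < l) (a i + 2 * b i + 2 * c i) + x + y + 2 * z =
  \sum_(k <= i < l) a i + (x + y) + 2 * (\sum_(k <= i < l) (b i + c i) + z).
Proof.
have -> : \sum_(k <= i < l) (a i + 2 * b i + 2 * c i) =
    \sum_(k <= i < l) a i + 2 * \sum_(k <= i < l) (b i + c i).
  by rewrite mulr_sumr -big_split; apply: eq_bigr => i _; rewrite -addrA -mulrDr.
by ring.
Qed.

Section cost_representation.
Variable s : nat.
Hypothesis sN : (s <= N)%N.

Let EL2 r (X : rv r) : L2 X -> L2 (EM s X).
Proof. by move=> X2; exact: l2F_L2 (l2F_condexp mdw sN X2). Qed.

Lemma represents_J y u v :
  (forall k, (s <= k <= N)%N -> L2 (state w sys s y u v k)) ->
  (forall k, (s <= k < N)%N -> L2 (stack u v k)) ->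
  rep s (J P N w sys W s y u v)
    (fun e => total_cost P N w W s e (state w sys s y u v) (stack u v)).
Proof.
set X := state w sys s y u v; set U := stack u v => X2 U2.
have XN : L2 (X N) by apply: X2; rewrite sN leqnn.
pose lin e k := inner P e (cst (wq W s k)) (X k) + inner P e (cst (wrho W s k)) (U k).
(* [v1] follows the summation order of [J], so that the closure lemmas apply term by term;
   [sum_regroup] then separates quadratic from linear terms. *)
pose v1 e := \sum_(s <= k < N) (inner P e (X k) (wQ W s k *f X k) +
    2 * inner P e (U k) (wS W s k *f X k)
  + inner P e (U k) (wR W s k *f U k)
  + inner P e (EM s (X k)) (wQb W s k *f EM s (X k))
  + 2 * inner P e (EM s (U k)) (wSb W s k *f EM s (X k))
  + inner P e (EM s (U k)) (wRb W s k *f EM s (U k))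
  + 2 * inner P e (cst (wq W s k)) (X k) + 2 * inner P e (cst (wrho W s k)) (U k))
  + inner P e (X N) (wG W s *f X N)
  + inner P e (EM s (X N)) (wGb W s *f EM s (X N))
  + 2 * inner P e (cst (wg W s)) (EM s (X N)).
apply: (@represents_eq _ _ _ _ _ _ _ _ v1).
  apply: (representsD mdw sN); last first.
    by apply: (representsZ mdw sN); apply: represents_dot; exact: EL2.
  apply: (representsD mdw sN); last by apply: represents_bil; exact: EL2.
  apply: (representsD mdw sN); last first.
    by apply: (represents_condexp mdw sN); exact: represents_bil.
  apply: (represents_sum mdw sN) => k skN; apply: (represents_condexp mdw sN).
  have Xk : L2 (X k) by apply: X2; lia.
  have Uk := U2 _ skN.
  have EX := EL2 Xk; have EU := EL2 Uk.
  do 2 (apply: (representsD mdw sN);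
    last by apply: (representsZ mdw sN); exact: represents_dot).
  apply: (representsD mdw sN); last exact: (represents_bil w s _ EU EU).
  apply: (representsD mdw sN);
    last by apply: (representsZ mdw sN); exact: (represents_bil w s _ EU EX).
  apply: (representsD mdw sN); last exact: (represents_bil w s _ EX EX).
  apply: (representsD mdw sN); last exact: (represents_bil w s _ Uk Uk).
  apply: (representsD mdw sN);
    last by apply: (representsZ mdw sN); exact: (represents_bil w s _ Uk Xk).
  exact: represents_bil.
move=> e Fe; rewrite /v1 /total_cost /quad_cost /linear_cost /final_quad.
exact: (sum_regroup s N (fun k => running_quad P w W s e k (X k) (U k))).
Qed.



Lemma mulmxf0 r c (M : 'M[R]_(r, c)) : M *f (cst 0 : rv c) = cst 0.
Proof. by apply/funext => x; rewrite /mulmxf mulmx0. Qed.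

(** On F_s-measurable vectors E_s is the identity almost surely, hence under the integral. *)
Lemma inner_condexp_mulmxf_l2F r c (M : 'M[R]_(r, c)) (X : rv r) (Y : rv c) e :
  F s e -> l2F s X -> l2F s Y ->
  inner P e (EM s X) (M *f EM s Y) = inner P e X (M *f Y).
Proof.
move=> Fe X2 Y2; have XL := l2F_L2 X2; have YL := l2F_L2 Y2.
rewrite (inner_condexp_mulmxfl mdw sN Fe)// -{1}[M]trmxK -inner_mulmxf.
rewrite (inner_condexp mdw sN Fe _ YL); last exact: l2F_mulmxf.
by rewrite inner_mulmxf trmxK.
Qed.

Lemma inner_stack_l e (u : nat -> rv m1) k (Z : rv m) :
  inner P e (stack u (cst (cst 0)) k) Z = inner P e (u k) (fun x => usubmx (Z x)).
Proof.
apply: eq_Rintegral => x _.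
by rewrite [stack _ _ _ _](_ : _ = col_mx (u k x) 0)// dot_col_mx dot0l addr0.
Qed.

Lemma inner_stack_r e (v : nat -> rv m2) k (Z : rv m) :
  inner P e (stack (cst (cst 0)) v k) Z = inner P e (v k) (fun x => dsubmx (Z x)).
Proof.
apply: eq_Rintegral => x _.
by rewrite [stack _ _ _ _](_ : _ = col_mx 0 (v k x))// dot_col_mx dot0l add0r.
Qed.

Lemma usub_mulmxf c (M : 'M[R]_(m, c)) (X : rv c) :
  (fun x => usubmx ((M *f X) x)) = usubmx M *f X.
Proof. by apply/funext => x; rewrite /mulmxf mul_usub_mx. Qed.

Lemma dsub_mulmxf c (M : 'M[R]_(m, c)) (X : rv c) :
  (fun x => dsubmx ((M *f X) x)) = dsubmx M *f X.
Proof. by apply/funext => x; rewrite /mulmxf mul_dsub_mx. Qed.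

Lemma mulmxfDl r c (M M' : 'M[R]_(r, c)) (X : rv c) :
  (M + M') *f X = M *f X + M' *f X.
Proof. by apply/funext => x; rewrite /mulmxf !fctE mulmxDl. Qed.

Lemma mulmxf_stack r (M : 'M[R]_(r, m)) (a : rv m1) (b : rv m2) :
  M *f (fun x => col_mx (a x) (b x)) = lsubmx M *f a + rsubmx M *f b.
Proof. by apply/funext => x; rewrite /mulmxf !fctE -{1}[M]hsubmxK mul_row_col. Qed.

Lemma running_quad_player1 e (a : nat -> rv n) (u : nat -> rv m1) k : F s e ->
  L2 (a k) -> L2 (u k) ->
  running_quad P w W s e k (a k) (stack u (cst (cst 0)) k) =
    inner P e (a k) (wQ W s k *f a k) + 2 * inner P e (u k) (S_1 W s k *f a k)
  + inner P e (u k) (R_11 W s k *f u k)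
  + inner P e (EM s (a k)) (wQb W s k *f EM s (a k))
  + 2 * inner P e (EM s (u k)) (Sb_1 W s k *f EM s (a k))
  + inner P e (EM s (u k)) (Rb_11 W s k *f EM s (u k)).
Proof.
move=> Fe a2 u2.
have U2 : L2 (stack u (cst (cst 0) : nat -> rv m2) k).
  by apply: stack_L2 => //; exact: L2_cst.
have me : measurable e := filtration_measurable mdw sN Fe.
have Z2 : L2 (cst 0 : rv m2) by exact: L2_cst.
rewrite /running_quad !(inner_condexp_mulmxfl mdw sN Fe)// !inner_stack_l !usub_mulmxf.
rewrite condexp_stack !mulmxf_stack mulmxf0 addr0.
rewrite (innerDr me u2 (L2_mulmxf _ (EL2 u2)) (L2_mulmxf _ (EL2 Z2))).
(* The chosen version of E_s applied to 0 need not be 0 everywhere. The conditional expectation is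
   moved onto the other factor, where 0 itself remains. *)
rewrite -[X in _ + (_ + X)](inner_condexp_mulmxfl mdw sN Fe)//.
rewrite (inner_condexp_mulmxfr mdw sN Fe _ u2 Z2) inner0r// addr0.
by rewrite /R_11 /Rb_11 /ulsubmx.
Qed.


Lemma represents_J1_tilde u :
  (forall k, (s <= k <= N)%N -> L2 (alpha w sys s u k)) ->
  (forall k, (s <= k < N)%N -> L2 (u k)) ->
  rep s (J1_tilde P N w sys W s u)
    (fun e => quad_cost P N w W s e (alpha w sys s u) (stack u (cst (cst 0)))).
Proof.
set a := alpha w sys s u => a2 u2.
have aN : L2 (a N) by apply: a2; rewrite sN leqnn.
pose v1 e := \sum_(s <= k < N) (
    inner P e (a k) (wQ W s k *f a k) + 2 * inner P e (u k) (S_1 W s k *f a k)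
  + inner P e (u k) (R_11 W s k *f u k)
  + inner P e (EM s (a k)) (wQb W s k *f EM s (a k))
  + 2 * inner P e (EM s (u k)) (Sb_1 W s k *f EM s (a k))
  + inner P e (EM s (u k)) (Rb_11 W s k *f EM s (u k)))
  + inner P e (a N) (wG W s *f a N)
  + inner P e (EM s (a N)) (wGb W s *f EM s (a N)).
apply: (@represents_eq _ _ _ _ _ _ _ _ v1).
  apply: (representsD mdw sN); last by apply: represents_bil; exact: EL2.
  apply: (representsD mdw sN); last first.
    by apply: (represents_condexp mdw sN); exact: represents_bil.
  apply: (represents_sum mdw sN) => k skN; apply: (represents_condexp mdw sN).
  have ak : L2 (a k) by apply: a2; lia.
  have uk := u2 _ skN.
  have Ea := EL2 ak; have Eu := EL2 uk.
  apply: (representsD mdw sN); last exact: (represents_bil w s _ Eu Eu).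
  apply: (representsD mdw sN);
    last by apply: (representsZ mdw sN); exact: (represents_bil w s _ Eu Ea).
  apply: (representsD mdw sN); last exact: (represents_bil w s _ Ea Ea).
  apply: (representsD mdw sN); last exact: (represents_bil w s _ uk uk).
  apply: (representsD mdw sN);
    last by apply: (representsZ mdw sN); exact: (represents_bil w s _ uk ak).
  exact: represents_bil.
move=> e Fe; rewrite /v1 /quad_cost /final_quad [RHS]addrA; congr (_ + _ + _).
apply: eq_big_nat => k skN; apply/esym/running_quad_player1 => //.
  by apply: a2; lia.
exact: u2.
Qed.

(** At time [s] the response is 0, and at other times the control is 0, so state-control terms never
    survive. The control term survives only at [s], where F_s-measurability of [vs] merges the plain
    and barred weights. *)
Lemma running_quad_player2 e (b : nat -> rv n) (vs : rv m2) l : F s e ->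
  L2 (b l) -> l2F s vs -> b s = cst 0 ->
  running_quad P w W s e l (b l) (stack (cst (cst 0)) (replace_at s vs (cst (cst 0))) l) =
    inner P e (b l) (wQ W s l *f b l)
  + inner P e (EM s (b l)) (wQb W s l *f EM s (b l))
  + (if l == s then inner P e vs (calR_22 W s s *f vs) else 0).
Proof.
move=> Fe b2 vs2 bs; set h := stack _ _ l.
have me : measurable e := filtration_measurable mdw sN Fe.
have h2 : l2F s h.
  apply: stack_l2F; first exact: l2F_cst.
  by rewrite /replace_at; case: ifP => _ //; exact: l2F_cst.
have hL := l2F_L2 h2.
rewrite /running_quad (inner_condexp_mulmxf_l2F (wRb W s l) Fe h2 h2).
have h_l : l != s -> h = stack (cst (cst 0)) (cst (cst 0)) l.
  by move=> /negbTE ls; apply/funext => x; rewrite /h /stack /replace_at ls.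
have inner_h0 Z : l != s -> inner P e h Z = 0.
  by move=> ls; rewrite h_l// inner_stack_r inner0l.
have SE : inner P e h (wS W s l *f b l) = 0.
  have [ls|/inner_h0//] := eqVneq l s.
  by rewrite ls bs mulmxf0 inner0r.
have SbE : inner P e (EM s h) (wSb W s l *f EM s (b l)) = 0.
  have [ls|ls] := eqVneq l s;
    last by rewrite (inner_condexp_mulmxfl mdw sN Fe)// inner_h0.
  rewrite inner_condexp_mulmxf_l2F//; last by rewrite ls bs; exact: l2F_cst.
  by rewrite ls bs mulmxf0 inner0r.
rewrite SE SbE !mulr0 !addr0 -!addrA; congr (_ + _).
rewrite addrCA; congr (_ + _).
have [ls|ls] := eqVneq l s; last by rewrite !inner_h0// addr0.
rewrite /h ls !inner_stack_r !dsub_mulmxf /stack !mulmxf_stack !mulmxf0 !add0r.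
rewrite /replace_at eqxx -innerDr//; first last.
- exact/L2_mulmxf/l2F_L2.
- exact/L2_mulmxf/l2F_L2.
- exact: l2F_L2.
by rewrite /calR_22 /R_22 /Rb_22 /drsubmx mulmxfDl.
Qed.

Lemma represents_J2_tilde vs : (s < N)%N ->
  (forall k, (s <= k <= N)%N -> L2 (beta w sys s vs k)) -> l2F s vs ->
  rep s (J2_tilde P N w sys W s vs)
    (fun e => quad_cost P N w W s e (beta w sys s vs)
       (stack (cst (cst 0)) (replace_at s vs (cst (cst 0))))).
Proof.
move=> ltsN; set b := beta w sys s vs => b2 vs2.
have bN : L2 (b N) by apply: b2; rewrite sN leqnn.
have vsL := l2F_L2 vs2.
pose v1 e := inner P e vs (calR_22 W s s *f vs) + \sum_(s <= l < N) (
    inner P e (b l) (wQ W s l *f b l)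
  + inner P e (EM s (b l)) (wQb W s l *f EM s (b l)))
  + inner P e (b N) (wG W s *f b N)
  + inner P e (EM s (b N)) (wGb W s *f EM s (b N)).
apply: (@represents_eq _ _ _ _ _ _ _ _ v1).
  apply: (representsD mdw sN); last by apply: represents_bil; exact: EL2.
  apply: (representsD mdw sN); last first.
    by apply: (represents_condexp mdw sN); exact: represents_bil.
  apply: (representsD mdw sN); first exact: represents_bil.
  apply: (represents_sum mdw sN) => k skN; apply: (represents_condexp mdw sN).
  have bk : L2 (b k) by apply: b2; lia.
  have Eb := EL2 bk.
  by apply: (representsD mdw sN);
    [exact: (represents_bil w s _ bk bk)|exact: (represents_bil w s _ Eb Eb)].
move=> e Fe; rewrite /v1 /quad_cost /final_quad [RHS]addrA; congr (_ + _ + _).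
have bs : b s = cst 0 by exact: beta_init.
(* The isolated control term becomes the contribution of [l = s] to the sum. *)
transitivity (\sum_(s <= l < N) ((inner P e (b l) (wQ W s l *f b l)
  + inner P e (EM s (b l)) (wQb W s l *f EM s (b l)))
  + (if l == s then inner P e vs (calR_22 W s s *f vs) else 0))).
  rewrite [RHS]big_split/= [RHS]addrC; congr (_ + _).
  rewrite big_ltn// eqxx big_nat_cond big1 ?addr0// => l /andP[/andP[sl _] _].
  by rewrite gtn_eqF.
apply: eq_big_nat => k skN; apply/esym/running_quad_player2 => //.
by apply: b2; lia.
Qed.

End cost_representation.
End costs.


Lemma addr_regroup (V : zmodType) (a b c d e f g h i : V) :
  a + b + ((c + e) + (d + f)) + i + (g + h) = a + b + c + d + e + f + g + h + i.
Proof. by rewrite !addrA [LHS](ACl (1*2*3*5*4*6*8*9*7)). Qed.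

(** * The costate and Hamiltonian in block form, and measurability of the costs *)

Section equilibrium.
Context {d : measure_display} {T : measurableType d} {R : realType}.
Variable P : probability T R.
Context {n m1 m2 p : nat}.
Variables (N : nat) (w : nat -> T -> 'cV[R]_p) (Delta : nat -> 'M[R]_p).
Variables (sys : system R n m1 m2 p) (W : weights R n m1 m2).
Hypothesis mdw : martingale_difference P w N Delta.

Local Notation m := (m1 + m2)%N.
Local Notation EM := (condexp_mx P w).
Local Notation rv r := (T -> 'cV[R]_r).
Local Notation l2F := (l2F P w).

Lemma mul_tr_stack (M : 'M[R]_(m, n)) (a : 'cV[R]_m1) (b : 'cV[R]_m2) :
  M^T *m col_mx a b = (usubmx M)^T *m a + (dsubmx M)^T *m b.
Proof. by rewrite -{1}[M]vsubmxK tr_col_mx mul_row_col. Qed.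

Lemma costate_adjoint s X u v :
  costate P N w sys W s X (stack u v) (adjoint P N w sys W s X u v).
Proof.
split; first by rewrite /adjoint run_back_final.
move=> k /andP[_ kN]; apply: (etrans (run_back_step _ _ kN)).
apply/funext => x; rewrite /grad_state /costate_state condexp_stack /mulmxf !fctE
  fct_sumE.
by rewrite /stack !mul_tr_stack addr_regroup.
Qed.

Lemma usub_hamiltonian_grad s X u v Y k :
  (fun x => usubmx (hamiltonian_grad P w sys W s X (stack u v) Y k x)) =
  fun x => S_1 W s k *m X k x + Sb_1 W s k *m EM s (X k) x
         + R_11 W s k *m u k x + Rb_11 W s k *m EM s (u k) x
         + R_12 W s k *m v k x + Rb_12 W s k *m EM s (v k) x
         + (sB1 sys k)^T *m EM k (Y k.+1) x
         + \sum_(i < p) (sD1 sys k i)^T *m EM k (fun z => w k z i 0 *: Y k.+1 z) x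
         + rho_1 W s k.
Proof.
apply/funext => x; rewrite /hamiltonian_grad /grad_control /costate_control.
rewrite condexp_stack /mulmxf !fctE fct_sumE /stack !linearD/= linear_sum/=.
rewrite -!mul_usub_mx tr_row_mx col_mxKu.
under eq_bigr do rewrite -mul_usub_mx tr_row_mx col_mxKu.
rewrite -[usubmx (wR W s k)]hsubmxK -[usubmx (wRb W s k)]hsubmxK !mul_row_col.
by rewrite addr_regroup.
Qed.

Lemma dsub_hamiltonian_grad s X u v Y k :
  (fun x => dsubmx (hamiltonian_grad P w sys W s X (stack u v) Y k x)) =
  fun x => S_2 W s k *m X k x + Sb_2 W s k *m EM s (X k) x
         + R_21 W s k *m u k x + Rb_21 W s k *m EM s (u k) x
         + R_22 W s k *m v k x + Rb_22 W s k *m EM s (v k) x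
         + (sB2 sys k)^T *m EM k (Y k.+1) x
         + \sum_(i < p) (sD2 sys k i)^T *m EM k (fun z => w k z i 0 *: Y k.+1 z) x
         + rho_2 W s k.
Proof.
apply/funext => x; rewrite /hamiltonian_grad /grad_control /costate_control.
rewrite condexp_stack /mulmxf !fctE fct_sumE /stack !linearD/= linear_sum/=.
rewrite -!mul_dsub_mx tr_row_mx col_mxKd.
under eq_bigr do rewrite -mul_dsub_mx tr_row_mx col_mxKd.
rewrite -[dsubmx (wR W s k)]hsubmxK -[dsubmx (wRb W s k)]hsubmxK !mul_row_col.
by rewrite addr_regroup.
Qed.

Lemma F_measurable_dot k r (c : 'cV[R]_r) (X : rv r) :
  (forall i, F_measurable w k (fun x => X x i 0)) ->
  F_measurable w k (fun x => dot c (X x)).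
Proof.
move=> mX; rewrite /F_measurable; under eq_fun do rewrite dotE.
by apply: measurable_sum => i; apply: measurable_funM => //; exact: mX.
Qed.

Lemma F_measurable_J s y u v : F_measurable w s (J P N w sys W s y u v).
Proof.
have mE r (X : rv r) i : F_measurable w s (fun x => EM s X x i 0).
  exact: F_measurable_condexp_mx.
apply: measurable_funD; last first.
  by apply: measurable_funM => //; apply: F_measurable_dot => i; exact: mE.
apply: measurable_funD; last by apply: F_measurable_bil => i; exact: mE.
apply: measurable_funD; last exact: F_measurable_condexp.
by apply: measurable_sum => k; exact: F_measurable_condexp.
Qed.

Lemma F_measurable_J1_tilde s u : F_measurable w s (J1_tilde P N w sys W s u).
Proof.
have mE r (X : rv r) i : F_measurable w s (fun x => EM s X x i 0).
  exact: F_measurable_condexp_mx.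
apply: measurable_funD; last by apply: F_measurable_bil => i; exact: mE.
apply: measurable_funD; last exact: F_measurable_condexp.
by apply: measurable_sum => k; exact: F_measurable_condexp.
Qed.

Lemma F_measurable_J2_tilde s vs : l2F s vs ->
  F_measurable w s (J2_tilde P N w sys W s vs).
Proof.
move=> vs2; have mE r (X : rv r) i : F_measurable w s (fun x => EM s X x i 0).
  exact: F_measurable_condexp_mx.
apply: measurable_funD; last by apply: F_measurable_bil => i; exact: mE.
apply: measurable_funD; last exact: F_measurable_condexp.
apply: measurable_funD; last by apply: measurable_sum => k; exact: F_measurable_condexp.
by apply: F_measurable_bil => i; have [] := vs2 i.
Qed.

End equilibrium.


(** * Optimality of each player *)

Lemma quadratic_ge0 (R : realFieldType) (a b : R) :
  (forall c : R, 0 <= c ^+ 2 * b + 2 * (c * a)) -> a = 0 /\ 0 <= b.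
Proof.
move=> H; have a0 : a = 0.
  apply/eqP; apply: contraT => an0.
  (* At c = -a/q the polynomial equals (a/q)^2 (b - 2q), which is negative for nonzero a because b
     <= |b| < 2q. *)
  pose q := `|b| + 1; have q0 : 0 < q by rewrite ltr_wpDl.
  have /(_ (- a / q)) := H.
  have -> : (- a / q) ^+ 2 * b + 2 * (- a / q * a) = (a / q) ^+ 2 * (b - 2 * q).
    by field; rewrite gt_eqF.
  rewrite pmulr_rge0; last by rewrite exprn_even_gt0//= mulf_neq0// invr_neq0// gt_eqF.
  have := ler_norm b; have := normr_ge0 b; rewrite /q; lra.
split=> //; have := H 1; rewrite a0; lra.
Qed.

Section equilibrium.
Context {d : measure_display} {T : measurableType d} {R : realType}.
Variable P : probability T R.
Context {n m1 m2 p : nat}.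
Variables (N : nat) (w : nat -> T -> 'cV[R]_p) (Delta : nat -> 'M[R]_p).
Variables (sys : system R n m1 m2 p).
Hypothesis mdw : martingale_difference P w N Delta.

Local Notation m := (m1 + m2)%N.
Local Notation E := (condexp P w).
Local Notation rv r := (T -> 'cV[R]_r).
Local Notation F k := <<s noise_gen w k >>.
Local Notation L2 := (L2 P).
Local Notation l2F := (l2F P w).
Local Notation rep := (represents P w).

Lemma inner_self_eq0 r (X : rv r) : L2 X -> inner P setT X X = 0 ->
  {ae P, forall x, 0 = X x}.
Proof.
move=> X2 X0; have iX := integrable_dot X2 X2.
have dot_ge0 x : 0 <= dot (X x) (X x).
  by rewrite dotE sumr_ge0// => i _; rewrite -expr2 sqr_ge0.
have fX := integrable_fin_num measurableT iX.
have : (\int[P]_x `|(dot (X x) (X x))%:E| = 0)%E.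
  rewrite (eq_integral (EFin \o (fun x => dot (X x) (X x)))).
    by rewrite -(fineK fX) -[fine _]/(inner P setT X X) X0.
  by move=> x _; rewrite /= ger0_norm.
move=> /(ae_eq_integral_abs _ measurableT (measurable_int _ iX)).
apply: filterS => x /(_ I)/= [XX0].
apply/colP => i; rewrite mxE.
have /psumr_eq0P/(_ i isT)/eqP : \sum_j X x j 0 * X x j 0 = 0 by rewrite -dotE.
by rewrite -expr2 sqrf_eq0 => /(_ (fun j _ => sqr_ge0 _))/eqP.
Qed.

Lemma inner_ae0 e r (h X : rv r) : measurable e -> L2 h -> L2 X ->
  {ae P, forall x, 0 = X x} -> inner P e h X = 0.
Proof.
move=> me h2 X2 X0; rewrite -[RHS](inner0r P me h) /inner /Rintegral; congr fine.
have mi (Z : rv r) : L2 Z -> measurable_fun e (fun x => (dot (h x) (Z x))%:E).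
  by move=> Z2; apply: measurable_funTS; exact: measurable_int (integrable_dot h2 Z2).
apply: ae_eq_integral => //; first exact: mi.
  by apply: mi; exact: L2_cst.
by apply: filterS X0 => x <- _.
Qed.

Lemma l2F_usub k (Z : rv m) : l2F k Z -> l2F k (fun x => usubmx (Z x)).
Proof. by move=> Z2 i; under eq_fun do rewrite mxE; exact: Z2. Qed.

Section variation.
Variables (W : weights R n m1 m2) (s : nat).
Hypotheses (symW : symmetric_weights N W) (sN : (s < N)%N).

Section extensionality.
Variables (e : set T) (X X' : nat -> rv n) (U U' : nat -> rv m).
Hypotheses (XX : forall k, (s <= k <= N)%N -> X k = X' k)
           (UU : forall k, (s <= k < N)%N -> U k = U' k).

Let XXN : X N = X' N.
Proof. by rewrite XX// leqnn ltnW. Qed.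

Let XXk k : (s <= k < N)%N -> X k = X' k.
Proof. by move=> /andP[sk kN]; rewrite XX// sk ltnW. Qed.

(** Pointwise equality is required only on the horizon, so a trajectory may replace the computed
    [state] without agreeing with it elsewhere. *)
Lemma quad_cost_ext : quad_cost P N w W s e X U = quad_cost P N w W s e X' U'.
Proof.
rewrite /quad_cost XXN; apply: (congr1 (+%R^~ _)).
by apply: eq_big_nat => k skN; rewrite (UU skN) (XXk skN).
Qed.

Lemma total_cost_ext : total_cost P N w W s e X U = total_cost P N w W s e X' U'.
Proof.
rewrite /total_cost quad_cost_ext; apply: (congr1 (fun z => _ + 2 * z)).
rewrite /linear_cost XXN; apply: (congr1 (+%R^~ _)).
by apply: eq_big_nat => k skN; rewrite (UU skN) (XXk skN).
Qed.

End extensionality.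

(* [X] may differ from [state s (X s) u v] off the horizon, so that the
   trajectory of an earlier initial time can be reused. *)
Lemma J_variation (X Y : nat -> rv n) u v u' v' (xi : nat -> rv n) (h : nat -> rv m) :
  l2F s (X s) -> trajectory N w sys s X (stack u v) ->
  (forall k, (s <= k < N)%N -> l2F k (stack u v k)) ->
  costate P N w sys W s X (stack u v) Y ->
  stack u' v' = stack u v + h ->
  (forall k, (s <= k < N)%N -> l2F k (h k)) ->
  xi s = cst 0 -> trajectory N w sys s xi h ->
  {ae P, forall x, J P N w sys W s (X s) u v x <= J P N w sys W s (X s) u' v' x} <->
  (forall e, F s e -> 0 <= quad_cost P N w W s e xi h +
    2 * \sum_(s <= k < N)
          inner P e (h k) (hamiltonian_grad P w sys W s X (stack u v) Y k)).
Proof.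
move=> Xs XU U2 cY U'E h2 xis xih.
have sN' := ltnW sN.
have X2 := trajectory_l2F mdw Xs U2 XU.
have xi0 : l2F s (xi s) by rewrite xis; exact: l2F_cst.
have xi2 := trajectory_l2F mdw xi0 h2 xih.
have sts a b : trajectory N w sys s (state w sys s (X s) a b) (stack a b).
  exact: trajectory_state.
have stE k : (s <= k <= N)%N -> state w sys s (X s) u v k = X k.
  by apply: (trajectory_unique _ _ (sts u v) XU); rewrite ?state_init.
have stE' k : (s <= k <= N)%N -> state w sys s (X s) u' v' k = (X + xi) k.
  apply: (trajectory_unique _ _ (sts u' v') (trajectoryD XU xih)).
  - by rewrite state_init [RHS](_ : _ = X s + xi s)// xis addr0.
  - by move=> l _; rewrite -U'E.
have repJ : rep s (J P N w sys W s (X s) u v)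
  (fun e => total_cost P N w W s e X (stack u v)).
  apply: represents_eq (represents_J W mdw sN' _ _) _.
  - by move=> k skN; rewrite stE//; exact: l2F_L2 (X2 _ skN).
  - by move=> k skN; exact: l2F_L2 (U2 _ skN).
  - by move=> e Fe; exact: total_cost_ext.
have repJ' : rep s (J P N w sys W s (X s) u' v')
    (fun e => total_cost P N w W s e (X + xi) (stack u v + h)).
  apply: represents_eq (represents_J W mdw sN' _ _) _.
  - move=> k skN; rewrite stE'//; apply: L2D; first exact: l2F_L2 (X2 _ skN).
    exact: l2F_L2 (xi2 _ skN).
  - move=> k skN; rewrite U'E; apply: L2D; first exact: l2F_L2 (U2 _ skN).
    exact: l2F_L2 (h2 _ skN).
  - by move=> e Fe; rewrite U'E; exact: total_cost_ext.
have key e : F s e -> total_cost P N w W s e (X + xi) (stack u v + h) -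
    total_cost P N w W s e X (stack u v) = quad_cost P N w W s e xi h +
    2 * \sum_(s <= k < N)
          inner P e (h k) (hamiltonian_grad P w sys W s X (stack u v) Y k).
  move=> Fe; rewrite (total_costD mdw symW sN' Fe sN _ _ cY h2 xis xih).
  - have alg (a b c : R) : a + b + c - a = b + c by ring.
    exact: alg.
  - by move=> k skN; exact: l2F_L2 (X2 _ skN).
  - by move=> k skN; exact: l2F_L2 (U2 _ skN).
rewrite (ae_le_represents mdw sN' _ _ repJ repJ'); try exact: F_measurable_J.
split=> H e Fe; first by rewrite -key// subr_ge0 H.
by rewrite -subr_ge0 key// H.
Qed.

End variation.

End equilibrium.


Lemma sum_nat_single (V : nmodType) (s N k : nat) (f : nat -> V) : (s <= k < N)%N ->
  (forall l, (s <= l < N)%N -> l != k -> f l = 0) -> \sum_(s <= l < N) f l = f k.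
Proof.
move=> skN f0; rewrite (bigD1_seq k) ?mem_index_iota ?iota_uniq//=.
by rewrite big1_seq ?addr0// => l /andP[lk]; rewrite mem_index_iota => /f0; exact.
Qed.

Section players.
Context {d : measure_display} {T : measurableType d} {R : realType}.
Variable P : probability T R.
Context {n m1 m2 p : nat}.
Variables (N : nat) (w : nat -> T -> 'cV[R]_p) (Delta : nat -> 'M[R]_p).
Variables (sys : system R n m1 m2 p).
Hypothesis mdw : martingale_difference P w N Delta.

Local Notation m := (m1 + m2)%N.
Local Notation rv r := (T -> 'cV[R]_r).
Local Notation F k := <<s noise_gen w k >>.
Local Notation L2 := (L2 P).
Local Notation l2F := (l2F P w).
Local Notation rep := (represents P w).
Local Notation l2Fp := (l2F_process P w N).

Variables (W : weights R n m1 m2) (s : nat).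
Hypotheses (symW : symmetric_weights N W) (sN : (s < N)%N).
Variables (X Y : nat -> rv n) (u : nat -> rv m1) (v : nat -> rv m2).
Hypotheses (Xs : l2F s (X s)) (u2 : l2Fp s u) (v2 : l2Fp s v).
Hypothesis XU : trajectory N w sys s X (stack u v).
Hypothesis cY : costate P N w sys W s X (stack u v) Y.

Let H k : rv m := hamiltonian_grad P w sys W s X (stack u v) Y k.
Let z1 : nat -> rv m1 := cst (cst 0).
Let z2 : nat -> rv m2 := cst (cst 0).
Let sN' := ltnW sN.

Let mF e : F s e -> measurable e.
Proof. exact: (filtration_measurable mdw). Qed.

Let U2 k : (s <= k < N)%N -> l2F k (stack u v k).
Proof. by move=> skN; apply: stack_l2F; [exact: u2|exact: v2]. Qed.

Let X2 k : (s <= k <= N)%N -> l2F k (X k).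
Proof. exact: (trajectory_l2F mdw Xs U2 XU). Qed.

Let Y2 k : (s <= k <= N)%N -> L2 (Y k).
Proof.
apply: (L2_costate mdw sN' _ _ cY) => l slN; first exact: l2F_L2 (X2 slN).
exact: l2F_L2 (U2 slN).
Qed.

Let l2F_H k : (s <= k < N)%N -> l2F k (H k).
Proof.
move=> skN; apply: (l2F_hamiltonian_grad _ _ mdw skN).
- by apply: X2; lia.
- exact: U2.
- by apply: Y2; lia.
Qed.

Let zero_rep : rep s (fun=> 0) (fun=> 0).
Proof. exact: (represents0 mdw sN'). Qed.

Let F_cst (c : R) : F_measurable w s (fun=> c).
Proof. exact: measurable_cst. Qed.

Section player1.

Let H1 k : rv m1 := fun x => usubmx (H k x).

Let H1_l2F k : (s <= k < N)%N -> l2F k (H1 k).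
Proof. by move=> skN; apply: l2F_usub; exact: l2F_H. Qed.

Let h2 (ub : nat -> rv m1) k : l2Fp s ub -> (s <= k < N)%N -> l2F k (stack ub z2 k).
Proof. by move=> ub2 skN; apply: stack_l2F; [exact: ub2|exact: l2F_cst]. Qed.

Let a2 ub k : l2Fp s ub -> (s <= k <= N)%N -> l2F k (alpha w sys s ub k).
Proof.
move=> ub2; apply: (trajectory_l2F mdw _ _ (trajectory_alpha (N := N) w sys ub)).
- by rewrite alpha_init; exact: l2F_cst.
- by move=> l; exact: h2.
Qed.

Let A e ub := quad_cost P N w W s e (alpha w sys s ub) (stack ub z2).
Let L e ub := \sum_(s <= k < N) inner P e (ub k) (H1 k).

(** Along a fixed direction the response is linear in the real scale [c], so the almost sure
    inequality becomes, for each event, a condition on a quadratic polynomial in [c]. *)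
Let J1_variation c ub : l2Fp s ub ->
  {ae P, forall x, J P N w sys W s (X s) u v x <=
    J P N w sys W s (X s) (u + c *: ub) v x} <->
  (forall e, F s e -> 0 <= c ^+ 2 * A e ub + 2 * (c * L e ub)).
Proof.
move=> ub2.
have uE : stack (u + c *: ub) v = stack u v + c *: stack ub z2.
  rewrite stackZ stackD; congr stack.
  by apply/funext => k; apply/funext => x; rewrite !fctE scaler0 addr0.
have ch2 k : (s <= k < N)%N -> l2F k ((c *: stack ub z2) k).
  by move=> skN; apply: l2FZ; exact: h2.
have ca : (c *: alpha w sys s ub) s = cst 0.
  by rewrite [LHS](_ : _ = c *: alpha w sys s ub s)// alpha_init; apply/funext => x;
    rewrite !fctE scaler0.
have ct := trajectoryZ c (trajectory_alpha (N := N) w sys ub).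
rewrite (J_variation mdw symW sN Xs XU U2 cY uE ch2 ca (ct s)).
have qE e : F s e -> quad_cost P N w W s e (c *: alpha w sys s ub) (c *: stack ub z2) =
    c ^+ 2 * A e ub.
  move=> Fe; apply: (quad_costZ W mdw sN' Fe) => k skN; first exact: l2F_L2 (a2 ub2 skN).
  exact: l2F_L2 (h2 ub2 skN).
have lE e : F s e -> \sum_(s <= k < N) inner P e ((c *: stack ub z2) k) (H k) =
  c * L e ub.
  move=> Fe; rewrite /L mulr_sumr; apply: eq_big_nat => k skN.
  rewrite -inner_stack_l; apply: (innerZl (mF Fe) c (l2F_L2 (h2 ub2 skN))).
  exact: l2F_L2 (l2F_H skN).
by split=> HH e Fe; have := HH e Fe; rewrite qE// lE.
Qed.

Let J1_tilde_ge0 ub : l2Fp s ub ->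
  {ae P, forall x, 0 <= J1_tilde P N w sys W s ub x} <-> (forall e, F s e -> 0 <= A e ub).
Proof.
move=> ub2; apply: (ae_le_represents mdw sN' _ _ zero_rep).
- exact: F_cst.
- exact: F_measurable_J1_tilde.
- apply: (represents_J1_tilde W mdw sN') => k skN; first exact: l2F_L2 (a2 ub2 skN).
  exact: l2F_L2 (ub2 _ skN).
Qed.

Lemma player1_optimal :
  (forall u', l2Fp s u' ->
    {ae P, forall x, J P N w sys W s (X s) u v x <= J P N w sys W s (X s) u' v x}) <->
  (forall k, (s <= k < N)%N -> {ae P, forall x, 0 = H1 k x}) /\
  (forall ub, l2Fp s ub -> {ae P, forall x, 0 <= J1_tilde P N w sys W s ub x}).
Proof.
split=> [opt|[H0 J0] u' u'2].
  have AL ub e : l2Fp s ub -> F s e -> L e ub = 0 /\ 0 <= A e ub.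
    move=> ub2 Fe; apply: quadratic_ge0 => c.
    apply: (J1_variation c ub2).1 => //; apply: opt => k skN.
    by apply: l2FD; [exact: u2|apply: l2FZ; exact: ub2].
  split=> [k skN|ub ub2]; last by apply/(J1_tilde_ge0 ub2) => e Fe;
    exact: (AL _ _ ub2 Fe).2.
  have HL := l2F_L2 (H1_l2F skN); apply: inner_self_eq0 => //.
  (* The gradient itself, used at time [k] only, is an admissible direction; its linear coefficient
     over the whole space is the expected squared norm of [H1 k]. *)
  pose ub := replace_at k (H1 k) z1.
  have ub2 : l2Fp s ub.
    move=> l slN; rewrite /ub /replace_at; case: eqP => [->|_]; first exact: H1_l2F.
    exact: l2F_cst.
  have FT : F s setT by exact: (@measurableT _ (g_sigma_algebraType (noise_gen w s))).
  have [<- _] := AL _ _ ub2 FT.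
  rewrite /L (sum_nat_single skN) => [|l _ lk]; first by rewrite /ub /replace_at eqxx.
  by rewrite /ub /replace_at (negbTE lk) inner0l.
have ub2 : l2Fp s (u' - u).
  move=> k skN; rewrite [(u' - u) k](_ : _ = u' k + (-1) *: u k); last first.
    by apply/funext => x; rewrite !fctE scaleN1r.
  by apply: l2FD; [exact: u'2|apply: l2FZ; exact: u2].
(* Every competitor is reached at scale 1, where the linear term is zero and the quadratic one
   nonnegative. *)
rewrite (_ : u' = u + 1 *: (u' - u)); last by rewrite scale1r addrC subrK.
apply/(J1_variation 1 ub2) => e Fe.
have -> : L e (u' - u) = 0.
  rewrite /L big_nat_cond big1// => k /andP[skN _].
  apply: inner_ae0; [exact: mF|exact: l2F_L2 (ub2 _ skN)|
    exact: l2F_L2 (H1_l2F skN)|exact: H0].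
by rewrite !mulr0 addr0 expr1n mul1r; exact: (J1_tilde_ge0 ub2).1 (J0 _ ub2) e Fe.
Qed.

End player1.

Section player2.

Let H2 k : rv m2 := fun x => dsubmx (H k x).

Let h2 (vs : rv m2) k : l2F s vs -> l2F s (stack z1 (replace_at s vs z2) k).
Proof.
move=> vs2; apply: stack_l2F; first exact: l2F_cst.
by rewrite /replace_at; case: eqP => // _; exact: l2F_cst.
Qed.

Let b2 vs k : l2F s vs -> (s <= k <= N)%N -> l2F k (beta w sys s vs k).
Proof.
move=> vs2; apply: (trajectory_l2F mdw _ _ (trajectory_beta (N := N) w sys vs)).
- by rewrite beta_init; exact: l2F_cst.
- by move=> l /andP[sl _]; apply: (l2F_mono sl); exact: h2.
Qed.

Let A e vs := quad_cost P N w W s e (beta w sys s vs) (stack z1 (replace_at s vs z2)).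

(** The direction is an impulse at [s], so the first-order sum reduces to its term at [s]. *)
Let J2_variation c vs : l2F s vs ->
  {ae P, forall x, J P N w sys W s (X s) u v x <=
    J P N w sys W s (X s) u (replace_at s (v s + c *: vs) v) x} <->
  (forall e, F s e -> 0 <= c ^+ 2 * A e vs + 2 * (c * inner P e vs (H2 s))).
Proof.
move=> vs2; set h := stack z1 (replace_at s vs z2).
have vE : stack u (replace_at s (v s + c *: vs) v) = stack u v + c *: h.
  rewrite stackZ stackD; congr stack; apply/funext => k; apply/funext => x.
    by rewrite !fctE scaler0 addr0.
  by rewrite /replace_at !fctE; case: eqP => [->//|_]; rewrite scaler0 addr0.
have ch2 k : (s <= k < N)%N -> l2F k ((c *: h) k).
  by move=> /andP[sk _]; apply: l2FZ; apply: (l2F_mono sk); exact: h2.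
have cb : (c *: beta w sys s vs) s = cst 0.
  by rewrite [LHS](_ : _ = c *: beta w sys s vs s)// beta_init; apply/funext => x;
    rewrite !fctE scaler0.
have ct : trajectory N w sys s (c *: beta w sys s vs) (c *: h).
  by apply: trajectoryZ; exact: trajectory_beta.
rewrite (J_variation mdw symW sN Xs XU U2 cY vE ch2 cb ct).
have qE e : F s e -> quad_cost P N w W s e (c *: beta w sys s vs) (c *: h) =
    c ^+ 2 * A e vs.
  move=> Fe; apply: (quad_costZ W mdw sN' Fe) => k skN; first exact: l2F_L2 (b2 vs2 skN).
  exact: l2F_L2 (h2 k vs2).
have lE e : F s e -> \sum_(s <= k < N) inner P e ((c *: h) k) (H k) =
    c * inner P e vs (H2 s).
  move=> Fe; have sE k : (s <= k < N)%N -> inner P e ((c *: h) k) (H k) =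
      c * inner P e (replace_at s vs z2 k) (H2 k).
    move=> skN; rewrite -inner_stack_r.
    by apply: (innerZl (mF Fe) c (l2F_L2 (h2 k vs2))); exact: l2F_L2 (l2F_H skN).
  rewrite (eq_big_nat _ _ sE) (@sum_nat_single _ _ _ s) ?leqnn// /replace_at ?eqxx//.
  by move=> l _ /negbTE ->; rewrite inner0l ?mulr0//; exact: mF.
by split=> HH e Fe; have := HH e Fe; rewrite qE// lE.
Qed.

Let J2_tilde_ge0 vs : l2F s vs ->
  {ae P, forall x, 0 <= J2_tilde P N w sys W s vs x} <-> (forall e, F s e -> 0 <= A e vs).
Proof.
move=> vs2; apply: (ae_le_represents mdw sN' _ _ zero_rep).
- exact: F_cst.
- exact: F_measurable_J2_tilde.
- apply: (represents_J2_tilde W mdw sN' sN) => // k skN; exact: l2F_L2 (b2 vs2 skN).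
Qed.

(** [G] stands for the stated form of the stationary condition, which agrees with [H2 s] only almost
    surely; equal integrals against F_s-measurable vectors suffice for both directions. *)
Variable G : rv m2.
Hypotheses (G2 : l2F s G)
  (HG : forall e vs, F s e -> l2F s vs -> inner P e vs (H2 s) = inner P e vs G).

Lemma player2_optimal :
  (forall vs, l2F s vs ->
    {ae P, forall x, J P N w sys W s (X s) u v x <=
                     J P N w sys W s (X s) u (replace_at s vs v) x}) <->
  {ae P, forall x, 0 = G x} /\
  (forall vs, l2F s vs -> {ae P, forall x, 0 <= J2_tilde P N w sys W s vs x}).
Proof.
have vs2 : l2F s (v s) by apply: v2; rewrite leqnn.
split=> [opt|[G0 J0] vs' vs'2].
  have AL vs e : l2F s vs -> F s e -> inner P e vs (H2 s) = 0 /\ 0 <= A e vs.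
    move=> vsF Fe; apply: quadratic_ge0 => c.
    apply: (J2_variation c vsF).1 => //; apply: opt.
    by apply: l2FD => //; exact: l2FZ.
  split=> [|vs vsF]; last by apply/(J2_tilde_ge0 vsF) => e Fe; exact: (AL _ _ vsF Fe).2.
  apply: inner_self_eq0; first exact: l2F_L2 G2.
  have FT : F s setT by exact: (@measurableT _ (g_sigma_algebraType (noise_gen w s))).
  by rewrite -HG//; exact: (AL _ _ G2 FT).1.
have dF : l2F s (vs' - v s).
  rewrite (_ : vs' - v s = vs' + (-1) *: v s); last first.
    by apply/funext => x; rewrite !fctE scaleN1r.
  by apply: l2FD => //; exact: l2FZ.
rewrite (_ : vs' = v s + 1 *: (vs' - v s)); last by rewrite scale1r addrC subrK.
apply/(J2_variation 1 dF) => e Fe.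
rewrite HG// (inner_ae0 (mF Fe) (l2F_L2 dF) (l2F_L2 G2) G0).
by rewrite !mulr0 addr0 expr1n mul1r; exact: (J2_tilde_ge0 dF).1 (J0 _ dF) e Fe.
Qed.

End player2.

End players.


(** * The stationary condition of the second player *)

Section second_player_gradient.
Context {d : measure_display} {T : measurableType d} {R : realType}.
Variable P : probability T R.
Context {n m1 m2 p : nat}.
Variables (N : nat) (w : nat -> T -> 'cV[R]_p) (Delta : nat -> 'M[R]_p).
Variables (sys : system R n m1 m2 p) (W : weights R n m1 m2).
Hypothesis mdw : martingale_difference P w N Delta.
Variables (k : nat) (X Y : nat -> T -> 'cV[R]_n).
Variables (u : nat -> T -> 'cV[R]_m1) (v : nat -> T -> 'cV[R]_m2).
Hypotheses (kN : (k < N)%N) (X2 : l2F P w k (X k)) (Y2 : L2 P (Y k.+1)).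
Hypotheses (u2 : l2F P w k (u k)) (v2 : l2F P w k (v k)).

Local Notation EM := (condexp_mx P w).
Local Notation rv r := (T -> 'cV[R]_r).
Local Notation F k := <<s noise_gen w k >>.
Local Notation "M *f X" := (mulmxf M X) (at level 40, left associativity).

(* [dsubmx] of [hamiltonian_grad] at s = k, with E_k X_k, E_k u_k and E_k v_k
   replaced by the a.s. equal X_k, u_k and v_k. *)
Definition second_player_grad : rv m2 := fun x =>
  calS_2 W k k *m X k x + calR_21 W k k *m u k x + calR_22 W k k *m v k x
  + (sB2 sys k)^T *m EM k (Y k.+1) x
  + \sum_(i < p) (sD2 sys k i)^T *m EM k (fun z => w k z i 0 *: Y k.+1 z) x
  + rho_2 W k k.

Let common : rv m2 :=
  S_2 W k k *f X k + R_21 W k k *f u k + R_22 W k k *f v k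
  + ((sB2 sys k)^T *f EM k (Y k.+1)
     + \sum_(i < p) (sD2 sys k i)^T *f EM k (noise_scale w k i (Y k.+1)))
  + cst (rho_2 W k k).

(** The barred terms, the only place where the block of the Hamiltonian gradient and the stated
    condition differ. *)
Let tail (a : rv n) (b : rv m1) (c : rv m2) : rv m2 :=
  Sb_2 W k k *f a + Rb_21 W k k *f b + Rb_22 W k k *f c.

Let regroup (V : zmodType) (a c g f h i b q j : V) :
  a + c + g + (f + h) + i + (b + q + j) = a + b + c + q + g + j + f + h + i.
Proof. by rewrite !addrA [LHS](ACl (1*7*2*8*3*9*4*5*6)). Qed.

Let gradE : second_player_grad = common + tail (X k) (u k) (v k).
Proof.
apply/funext => x; rewrite /second_player_grad /common /tail /mulmxf !fctE fct_sumE
  regroup.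
by rewrite /calS_2 /calR_21 /calR_22 !mulmxDl !addrA.
Qed.

Let hamE : (fun x => dsubmx (hamiltonian_grad P w sys W k X (stack u v) Y k x)) =
  common + tail (EM k (X k)) (EM k (u k)) (EM k (v k)).
Proof.
rewrite dsub_hamiltonian_grad; apply/funext => x.
by rewrite /common /tail /mulmxf !fctE fct_sumE regroup.
Qed.

Let l2F_common : l2F P w k common.
Proof.
apply: l2FD; last exact: l2F_cst.
apply: l2FD; first by apply: l2FD; [apply: l2FD|]; exact: l2F_mulmxf.
apply: l2FD; first by apply: l2F_mulmxf; apply: (l2F_condexp mdw) => //; exact: ltnW.
by apply: l2F_sum => i; apply: l2F_mulmxf; exact: (l2F_condexp_noise mdw).
Qed.

Let l2F_tail a b c : l2F P w k a -> l2F P w k b -> l2F P w k c ->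
  l2F P w k (tail a b c).
Proof. by move=> a2 b2 c2; apply: l2FD; [apply: l2FD|]; exact: l2F_mulmxf. Qed.

Lemma l2F_second_player_grad : l2F P w k second_player_grad.
Proof. by rewrite gradE; apply: l2FD => //; exact: l2F_tail. Qed.

(** Transposing the weight puts an F_k-measurable factor against E_k Z, whose conditional
    expectation can then be dropped. *)
Lemma inner_second_player_grad e h : F k e -> l2F P w k h ->
  inner P e h (fun x => dsubmx (hamiltonian_grad P w sys W k X (stack u v) Y k x)) =
  inner P e h second_player_grad.
Proof.
move=> Fe hF; have h2 := l2F_L2 hF; have kN' := ltnW kN.
have me : measurable e := filtration_measurable mdw kN' Fe.
have EF r (Z : rv r) : l2F P w k Z -> l2F P w k (EM k Z).
  by move=> /l2F_L2 Z2; exact: (l2F_condexp mdw).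
have termE r (M : 'M[R]_(m2, r)) (Z : rv r) : l2F P w k Z ->
    inner P e h (M *f EM k Z) = inner P e h (M *f Z).
  move=> Z2; rewrite -{1}[M]trmxK -inner_mulmxf.
  rewrite (inner_condexp mdw kN' Fe _ (l2F_L2 Z2)); last exact: l2F_mulmxf.
  by rewrite inner_mulmxf trmxK.
have tailE a b c : l2F P w k a -> l2F P w k b -> l2F P w k c ->
    inner P e h (tail a b c) = inner P e h (Sb_2 W k k *f a)
      + inner P e h (Rb_21 W k k *f b) + inner P e h (Rb_22 W k k *f c).
  move=> /l2F_L2 a2 /l2F_L2 b2 /l2F_L2 c2; rewrite /tail.
  have aM := L2_mulmxf (Sb_2 W k k) a2; have bM := L2_mulmxf (Rb_21 W k k) b2.
  have cM := L2_mulmxf (Rb_22 W k k) c2.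
  by rewrite (innerDr me h2 (L2D aM bM) cM) (innerDr me h2 aM bM).
have c2 := l2F_L2 l2F_common.
rewrite hamE gradE.
rewrite (innerDr me h2 c2 (l2F_L2 (l2F_tail (EF _ _ X2) (EF _ _ u2) (EF _ _ v2)))).
rewrite (innerDr me h2 c2 (l2F_L2 (l2F_tail X2 u2 v2))).
rewrite (tailE _ _ _ (EF _ _ X2) (EF _ _ u2) (EF _ _ v2)) (tailE _ _ _ X2 u2 v2).
by rewrite (termE _ _ _ X2) (termE _ _ _ u2) (termE _ _ _ v2).
Qed.

End second_player_gradient.

(** * Equivalence of equilibrium with the stationary and convex conditions *)

Section equivalence.
Context {d : measure_display} {T : measurableType d} {R : realType}.
Variable P : probability T R.
Context {n m1 m2 p : nat}.
Variables (N : nat) (w : nat -> T -> 'cV[R]_p) (Delta : nat -> 'M[R]_p).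
Variables (sys : system R n m1 m2 p) (W1 W2 : weights R n m1 m2).
Variables (t : nat) (y : T -> 'cV[R]_n).
Hypotheses (mdw : martingale_difference P w N Delta)
  (sym1 : symmetric_weights N W1) (sym2 : symmetric_weights N W2)
  (tN : (t < N)%N) (y2 : l2F P w t y).

(** The equivalence holds for each admissible pair, not only for existence. The second player's
    deviation at [k] concerns time [k] alone, so the requirements for different [k] are treated
    independently. *)
Lemma open_loop_equilibriumP u v :
  l2F_process P w N t u -> l2F_process P w N t v ->
  open_loop_equilibrium P N w sys W1 W2 t y u v <->
  stationary P N w sys W1 W2 t y u v /\ convex_conditions P N w sys W1 W2 t.
Proof.
move=> u2 v2; pose X := state w sys t y u v.
have Xt : X t = y by exact: state_init.
have Xt2 : l2F P w t (X t) by rewrite Xt.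
have XU : trajectory N w sys t X (stack u v) by exact: trajectory_state.
have X2 k : (t <= k <= N)%N -> l2F P w k (X k).
  apply: (trajectory_l2F mdw Xt2 _ XU) => l tlN.
  by apply: stack_l2F; [exact: u2|exact: v2].
have opt1 := player1_optimal mdw sym1 tN Xt2 u2 v2 XU
  (costate_adjoint P N w sys W1 t X u v).
rewrite Xt in opt1.
have u2k k : (t <= k)%N -> l2F_process P w N k u.
  by move=> tk l /andP[kl lN]; apply: u2; rewrite (leq_trans tk).
have v2k k : (t <= k)%N -> l2F_process P w N k v.
  by move=> tk l /andP[kl lN]; apply: v2; rewrite (leq_trans tk).
have opt2 k : (t <= k < N)%N ->
    (forall vk, l2F P w k vk ->
      {ae P, forall x, J P N w sys W2 k (X k) u v x <=
                       J P N w sys W2 k (X k) u (replace_at k vk v) x}) <->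
    {ae P, forall x, 0 = second_player_grad P w sys W2 k X
        (adjoint P N w sys W2 k X u v) u v x} /\
    (forall vk, l2F P w k vk ->
      {ae P, forall x, 0 <= J2_tilde P N w sys W2 k vk x}).
  move=> /andP[tk kN].
  have Xk2 : l2F P w k (X k) by apply: X2; rewrite tk ltnW.
  have cY := costate_adjoint P N w sys W2 k X u v.
  (* The cost at [k] starts from X_k, so the tail of the same trajectory serves and no new state is
     introduced. *)
  have XUk := sub_trajectory tk XU.
  have Y2 : L2 P (adjoint P N w sys W2 k X u v k.+1).
    apply: (L2_costate mdw (ltnW kN) _ _ cY); last by rewrite leqnSn.
    - by move=> l /andP[kl lN]; apply: l2F_L2 (X2 l _); rewrite (leq_trans tk).
    - move=> l klN; suff /l2F_L2 : l2F P w l (stack u v l) by [].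
      by apply: stack_l2F; [exact: (u2k _ tk)|exact: (v2k _ tk)].
  have uk : l2F P w k (u k) by apply: u2; rewrite tk.
  have vk : l2F P w k (v k) by apply: v2; rewrite tk.
  apply: (player2_optimal mdw sym2 kN Xk2 (u2k _ tk) (v2k _ tk) XUk cY).
    exact: (l2F_second_player_grad _ _ mdw).
  by move=> e vs Fe vs2; exact: (inner_second_player_grad sys W2 mdw kN Xk2 Y2 uk vk Fe
    vs2).
have stat1E k : {ae P, forall x, 0 = usubmx
      (hamiltonian_grad P w sys W1 t X (stack u v)
        (adjoint P N w sys W1 t X u v) k x)} <->
    {ae P, forall x,
       0 = S_1 W1 t k *m X k x + Sb_1 W1 t k *m condexp_mx P w t (X k) x
         + R_11 W1 t k *m u k x + Rb_11 W1 t k *m condexp_mx P w t (u k) x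
         + R_12 W1 t k *m v k x + Rb_12 W1 t k *m condexp_mx P w t (v k) x
         + (sB1 sys k)^T *m condexp_mx P w k (adjoint P N w sys W1 t X u v k.+1) x
         + \sum_(i < p) (sD1 sys k i)^T *m condexp_mx P w k
             (fun z => w k z i 0 *: adjoint P N w sys W1 t X u v k.+1 z) x
         + rho_1 W1 t k}.
  have UE := usub_hamiltonian_grad P w sys W1 t X u v (adjoint P N w sys W1 t X u v) k.
  split; apply: filterS => x E0; first exact: (etrans E0 (congr1 (@^~ x) UE)).
  exact: (etrans E0 (esym (congr1 (@^~ x) UE))).
split.
- move=> [_ _ /opt1[H1 c1] eq2]; split.
    move=> k tkN; split; first by apply/stat1E; exact: H1.
    by have [] := (opt2 k tkN).1 (eq2 k tkN).
  by split=> // k tkN; have [] := (opt2 k tkN).1 (eq2 k tkN).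
- move=> [st [c1 c2]]; split => //.
    by apply/opt1; split => // k tkN; apply/stat1E; exact: (st k tkN).1.
  by move=> k tkN; apply/(opt2 k tkN); split; [exact: (st k tkN).2|exact: c2].
Qed.

End equivalence.

Theorem theorem2p1 (d : measure_display) (T : measurableType d) (R : realType)
    (P : probability T R) (N n m1 m2 p : nat)
    (w : nat -> T -> 'cV[R]_p) (Delta : nat -> 'M[R]_p)
    (sys : system R n m1 m2 p) (W1 W2 : weights R n m1 m2)
    (t : nat) (y : T -> 'cV[R]_n) :
  (1 <= N)%N ->
  martingale_difference P w N Delta ->
  symmetric_weights N W1 ->
  symmetric_weights N W2 ->
  (t < N)%N ->
  l2F P w t y ->
  let satisfies_ii (u : nat -> T -> 'cV[R]_m1) (v : nat -> T -> 'cV[R]_m2) :=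
    [/\ l2F_process P w N t u, l2F_process P w N t v,
        stationary P N w sys W1 W2 t y u v &
        convex_conditions P N w sys W1 W2 t] in
  ((exists u v, open_loop_equilibrium P N w sys W1 W2 t y u v)
   <-> (exists u v, satisfies_ii u v)) /\
  (forall u v, satisfies_ii u v ->
     open_loop_equilibrium P N w sys W1 W2 t y u v).
Proof.
move=> N1 mdw sym1 sym2 tN y2 satisfies_ii.
have iiP u v : satisfies_ii u v -> open_loop_equilibrium P N w sys W1 W2 t y u v.
  move=> [u2 v2 st cv].
  exact: (open_loop_equilibriumP sys mdw sym1 sym2 tN y2 u2 v2).2 (conj st cv).
split=> //; split=> [[u [v eq]]|[u [v ii]]]; exists u, v; last exact: iiP.
have [u2 v2 _ _] := eq.
by have [st cv] := (open_loop_equilibriumP sys mdw sym1 sym2 tN y2 u2 v2).1 eq.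
Qed.
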